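(* Let $\tau$ lie in the complex upper half plane, $q=e^{2\pi i\tau}$, and let $\eta(\tau)=q^{1/24}\prod_{n\ge1}(1-q^n)$ be the Dedekind eta function. Define $$t(\tau)=\frac12\,\frac{\eta(\tau)^4\eta(4\tau)^2\eta(8\tau)^4}{\eta(2\tau)^{10}},\qquad f(\tau)=\frac{\eta(2\tau)^{10}}{\eta(\tau)^4\eta(4\tau)^4}.$$ Then in a neighbourhood of $\tau=i\infty$ we have $$\sum_{n\ge0}P_n\,t(\tau)^n=f(\tau),$$ where $(P_n)_{n\ge0}$ are the Catalan-Larcombe-French numbers.
   Context: The Catalan-Larcombe-French numbers are defined by $P_0=1$, $P_1=8$ and, for $n\ge 2$, $n^2P_n-8(3n^2-3n+1)P_{n-1}+128(n-1)^2P_{n-2}=0$. *)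

(* Defs.v *)
From Stdlib Require Import Reals.
From Coquelicot Require Import Coquelicot.
Open Scope R_scope.

Definition Cexp (z : C) : C :=
  (exp (Re z) * cos (Im z), exp (Re z) * sin (Im z)).

Definition qnome (tau : C) : C := Cexp (Cmult (RtoC (2 * PI)) (Cmult Ci tau)).

Fixpoint eta_partial (q : C) (N : nat) : C :=
  match N with
  | O => RtoC 1
  | S M => Cmult (eta_partial q M) (Cminus (RtoC 1) (Cpow q (S M)))
  end.

(* the infinite product prod_{n>=1}(1 - q^n), as the limit of partial
   products (taken componentwise; it converges for |q| < 1) *)
Definition eta_prod (q : C) : C :=
  (real (Lim_seq (fun N => Re (eta_partial q N))),
   real (Lim_seq (fun N => Im (eta_partial q N)))).

Definition eta (tau : C) : C :=
  Cmult (Cexp (Cmult (RtoC (2 * PI / 24)) (Cmult Ci tau))) (eta_prod (qnome tau)).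

Definition tfun (tau : C) : C :=
  Cdiv (Cmult (RtoC (1/2))
          (Cmult (Cmult (Cpow (eta tau) 4) (Cpow (eta (Cmult (RtoC 4) tau)) 2))
                 (Cpow (eta (Cmult (RtoC 8) tau)) 4)))
       (Cpow (eta (Cmult (RtoC 2) tau)) 10).

Definition ffun (tau : C) : C :=
  Cdiv (Cpow (eta (Cmult (RtoC 2) tau)) 10)
       (Cmult (Cpow (eta tau) 4) (Cpow (eta (Cmult (RtoC 4) tau)) 4)).

Definition is_CLF (P : nat -> R) : Prop :=
  P 0%nat = 1 /\ P 1%nat = 8 /\
  forall n : nat, (2 <= n)%nat ->
    (INR n)^2 * P n - 8 * (3 * (INR n)^2 - 3 * INR n + 1) * P (n - 1)%nat
      + 128 * (INR n - 1)^2 * P (n - 2)%nat = 0.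

(* Main.v *)
Require Import Defs.
From Stdlib Require Import Reals Lra Lia.
From Coquelicot Require Import Coquelicot.
Open Scope R_scope.

(** Write [E q] for the Euler product and [theta q = E(q^2)^5 / (E(q)^2 E(q^4)^2)], which is the
    series [1 + 2 (q + q^4 + q^9 + ...)] by a finite identity of Shanks' type.  Then [f = theta(q)^2],
    and [16 t = 1 - theta(-q)^2 / theta(q)^2].  The two relations
    [theta(q) theta(-q) = theta(-q^2)^2] and [theta(q)^2 + theta(-q)^2 = 2 theta(q^2)^2] say that
    [q -> q^2] acts on the pair [(theta(q)^2, theta(-q)^2)] as one step of the arithmetic-geometric
    mean.  On the other side, the recurrence for [P] is a second order differential equation for
    [G(z) = sum P_n z^n], and a Wronskian argument shows that [G] obeys the quadratic (Landen)
    transformation that goes with such a step.  Hence [G(t(q)) - theta(q)^2] is multiplied by a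
    factor close to 1 under [q -> q^2]; as it is [O(q)] it must vanish.  The same contraction
    principle proves the theta relations. *)

(** The closed form in the background is [G(z) = 1 / AGM(1, 1 - 16 z)]. It explains the 16 in
    [16 t]: the two arguments of the mean become [1] and [theta(-q)^2 / theta(q)^2]. Written in the
    variable [z], a Landen step involves square roots. They disappear in the variable [y = (theta(q)
    - theta(-q)) / (theta(q) + theta(-q))]: [t(q)], [t(q^2)] and the multiplier
    [theta(q^2)^2 / theta(q)^2] are all rational in [y], so what has to be checked about the step is
    a set of rational identities. The differential equation is singular at [z = 0], where a second
    solution has a logarithm, so comparing values at 0 does not by itself identify a solution. The
    Wronskian is therefore weighted by the leading coefficient of the equation. This weight vanishes
    at 0, so for functions regular there the constant Wronskian is 0. *)

(** * Limits of complex sequences, taken by components as in [eta_prod] *)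

Definition Ccv (u : nat -> C) (l : C) : Prop :=
  is_lim_seq (fun n => Re (u n)) (Re l) /\ is_lim_seq (fun n => Im (u n)) (Im l).

Lemma im_le_Cmod (z : C) : Rabs (Im z) <= Cmod z.
Proof.
  apply Rle_trans with (2 := Rmax_Cmod z). apply Rmax_r.
Qed.

Lemma Ccv_unique (u : nat -> C) (l l' : C) : Ccv u l -> Ccv u l' -> l = l'.
Proof.
  intros [H1 H2] [H3 H4]. apply injective_projections.
  - apply is_lim_seq_unique in H1, H3. change (Re l = Re l'). congruence.
  - apply is_lim_seq_unique in H2, H4. change (Im l = Im l'). congruence.
Qed.

Lemma Ccv_ext (u v : nat -> C) (l : C) : (forall n, u n = v n) -> Ccv u l -> Ccv v l.
Proof.
  intros E [H1 H2]; split.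
  - apply is_lim_seq_ext with (2 := H1); intros n; now rewrite E.
  - apply is_lim_seq_ext with (2 := H2); intros n; now rewrite E.
Qed.

Lemma Ccv_const (c : C) : Ccv (fun _ => c) c.
Proof. split; apply is_lim_seq_const. Qed.

Lemma Ccv_plus (u v : nat -> C) (a b : C) :
  Ccv u a -> Ccv v b -> Ccv (fun n => u n + v n)%C (a + b)%C.
Proof. intros [H1 H2] [H3 H4]; split; now apply is_lim_seq_plus'. Qed.

Lemma Ccv_mult (u v : nat -> C) (a b : C) :
  Ccv u a -> Ccv v b -> Ccv (fun n => u n * v n)%C (a * b)%C.
Proof.
  intros [H1 H2] [H3 H4]; split.
  - apply is_lim_seq_minus'; now apply is_lim_seq_mult'.
  - apply is_lim_seq_plus'; now apply is_lim_seq_mult'.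
Qed.

Lemma Ccv_subseq (u : nat -> C) (l : C) (phi : nat -> nat) :
  (forall n, (phi n < phi (S n))%nat) -> Ccv u l -> Ccv (fun n => u (phi n)) l.
Proof.
  intros Hphi [H1 H2].
  assert (F := eventually_subseq phi Hphi).
  split; [exact (is_lim_seq_subseq _ _ phi F H1) | exact (is_lim_seq_subseq _ _ phi F H2)].
Qed.

Lemma Ccv_0 (u : nat -> C) (v : nat -> R) :
  (forall n, Cmod (u n) <= v n) -> is_lim_seq v 0 -> Ccv u 0.
Proof.
  intros H Hv; split; apply is_lim_seq_abs_0;
    apply is_lim_seq_le_le with (u := fun _ => 0) (w := v); trivial;
    try apply is_lim_seq_const; intros n; split; try apply Rabs_pos;
    apply Rle_trans with (2 := H n); [apply re_le_Cmod | apply im_le_Cmod].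
Qed.

(** The squared modulus is a polynomial in the components, so its limit follows from theirs. *)
Lemma Ccv_bound (u : nat -> C) (l c : C) (B : R) :
  (forall n, Cmod (u n - c) <= B) -> Ccv u l -> Cmod (l - c) <= B.
Proof.
  intros H Hu.
  assert (HB : 0 <= B) by (apply Rle_trans with (2 := H 0%nat), Cmod_ge_0).
  destruct (Ccv_plus _ _ _ _ Hu (Ccv_const (- c)%C)) as [H1 H2].
  assert (L : Rbar_le (Cmod (l - c) ^ 2) (B ^ 2)).
  { apply is_lim_seq_le with (u := fun n => Cmod (u n - c)%C ^ 2) (v := fun _ => B ^ 2).
    - intros n. apply pow_incr. split; [apply Cmod_ge_0 | apply H].
    - apply is_lim_seq_ext with
        (u := fun n => Re (u n + - c)%C * Re (u n + - c)%C + Im (u n + - c)%C * Im (u n + - c)%C).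
      + intros n. rewrite Cmod2_alt. unfold Cminus. ring.
      + rewrite Cmod2_alt.
        replace (Finite (Re (l - c) ^ 2 + Im (l - c) ^ 2)) with
          (Finite (Re (l + - c)%C * Re (l + - c)%C + Im (l + - c)%C * Im (l + - c)%C))
          by (unfold Cminus; f_equal; ring).
        apply is_lim_seq_plus'; now apply is_lim_seq_mult'.
    - apply is_lim_seq_const. }
  simpl Rbar_le in L.
  apply Rsqr_incr_0_var; trivial. unfold Rsqr. lra.
Qed.

(** * The Euler product *)

Notation E := eta_prod.

(** The two bounds support each other: the bound 2 makes the next increment at most [2 * |q|^(N+1)],
    and 8/3 is chosen so that [8/3 * (1 - |q|) >= 2] for [|q| <= 1/4]. The factor [1 - |q|^N] comes
    from the partial geometric sum and lets the induction close. *)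
Lemma eta_partial_bound (q : C) (N : nat) : Cmod q <= 1/4 ->
  Cmod (eta_partial q N - 1) <= 8 / 3 * (Cmod q * (1 - Cmod q ^ N)) /\
  Cmod (eta_partial q N) <= 2.
Proof.
  intros Hq. assert (H0 := Cmod_ge_0 q).
  assert (A : forall M, 0 <= Cmod q ^ M <= 1).
  { intros M; split; [now apply pow_le|]. rewrite <- (pow1 M). apply pow_incr; lra. }
  assert (B : forall z : C, Cmod (z - 1) <= 2/3 -> Cmod z <= 2).
  { intros z Hz. replace z with (z - 1 + 1)%C by ring.
    eapply Rle_trans; [apply Cmod_triangle|]. rewrite Cmod_1. lra. }
  induction N as [|N [IH1 IH2]].
  - simpl. replace (1 - 1)%C with (RtoC 0) by ring. rewrite Cmod_0, Cmod_1. lra.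
  - enough (F : Cmod (eta_partial q (S N) - 1) <= 8 / 3 * (Cmod q * (1 - Cmod q ^ S N))).
    { split; trivial. apply B. apply Rle_trans with (1 := F).
      assert (G := A (S N)). nra. }
    simpl eta_partial.
    replace (eta_partial q N * (1 - q * q ^ N) - 1)%C with
      ((eta_partial q N - 1) + - (eta_partial q N * (q * q ^ N)))%C by ring.
    eapply Rle_trans; [apply Cmod_triangle|].
    rewrite Cmod_opp, !Cmod_mult, Cmod_pow.
    assert (G := A N). simpl. set (x := Cmod q ^ N) in *.
    assert (Cmod (eta_partial q N) * (Cmod q * x) <= 2 * (Cmod q * x)).
    { apply Rmult_le_compat_r; trivial. now apply Rmult_le_pos. }
    assert (0 <= Cmod q * x) by now apply Rmult_le_pos.
    nra.
Qed.

Lemma real_increment_cv (u : nat -> R) (r : R) : 0 <= r < 1 ->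
  (forall n, Rabs (u (S n) - u n) <= 2 * r ^ S n) -> is_lim_seq u (real (Lim_seq u)).
Proof.
  intros Hr H.
  assert (X : ex_series (fun n => u (S n) - u n)).
  { apply (ex_series_le (K := R_AbsRing) (V := R_CompleteNormedModule)) with (b := fun n => 2 * r * r ^ n).
    - intros n. unfold norm; simpl. unfold abs; simpl. specialize (H n). simpl in H. lra.
    - apply (ex_series_scal (K := R_AbsRing) (V := R_NormedModule) (2 * r) (fun n => r ^ n)).
      exists (/ (1 - r)). apply is_series_geom.
      rewrite Rabs_pos_eq; lra. }
  destruct X as [l Hl].
  assert (Y : is_lim_seq u (l + u 0%nat)).
  { apply is_lim_seq_incr_1.
    apply is_lim_seq_ext with (u := fun n => sum_n (fun n => u (S n) - u n) n + u 0%nat).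
    - intros n. induction n as [|n IH].
      + rewrite sum_O. ring.
      + rewrite sum_Sn. unfold plus; simpl. lra.
    - apply is_lim_seq_plus'; [exact Hl | apply is_lim_seq_const]. }
  rewrite (is_lim_seq_unique _ _ Y). exact Y.
Qed.

(** [Lim_seq] followed by [real] yields a value for every sequence; the geometric increments show
    that here it is a genuine limit. *)
Lemma eta_prod_cv (q : C) : Cmod q <= 1/4 -> Ccv (eta_partial q) (E q).
Proof.
  intros Hq. assert (H0 := Cmod_ge_0 q).
  assert (D : forall n, Cmod (eta_partial q (S n) - eta_partial q n) <= 2 * Cmod q ^ S n).
  { intros n. simpl eta_partial.
    replace (eta_partial q n * (1 - q * q ^ n) - eta_partial q n)%C with
      (- (eta_partial q n * q ^ S n))%C by (simpl; ring).
    rewrite Cmod_opp, Cmod_mult, Cmod_pow.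
    apply Rmult_le_compat_r; [now apply pow_le|]. now apply eta_partial_bound. }
  split; apply real_increment_cv with (r := Cmod q); try lra; intros n;
    apply Rle_trans with (2 := D n).
  - apply (re_le_Cmod (eta_partial q (S n) - eta_partial q n)).
  - apply (im_le_Cmod (eta_partial q (S n) - eta_partial q n)).
Qed.

Lemma eta_prod_near_1 (q : C) : Cmod q <= 1/4 -> Cmod (E q - 1) <= 8 / 3 * Cmod q.
Proof.
  intros Hq. assert (H0 := Cmod_ge_0 q).
  apply Ccv_bound with (2 := eta_prod_cv q Hq). intros n.
  apply Rle_trans with (1 := proj1 (eta_partial_bound q n Hq)).
  assert (0 <= Cmod q ^ n) by now apply pow_le. nra.
Qed.

Lemma near_1_neq_0 (z : C) : Cmod (z - 1) < 1 -> z <> 0.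
Proof.
  intros H ->. replace (0 - 1)%C with (- (1))%C in H by ring. rewrite Cmod_m1 in H. lra.
Qed.

Lemma eta_prod_neq_0 (q : C) : Cmod q <= 1/4 -> E q <> 0.
Proof.
  intros Hq. apply near_1_neq_0. assert (H := eta_prod_near_1 q Hq). lra.
Qed.

Lemma eta_partial_neq_0 (q : C) (n : nat) : Cmod q <= 1/4 -> eta_partial q n <> 0.
Proof.
  intros Hq. apply near_1_neq_0. destruct (eta_partial_bound q n Hq) as [H _].
  assert (H0 := Cmod_ge_0 q). assert (0 <= Cmod q ^ n) by now apply pow_le. nra.
Qed.

Lemma eta_partial_S (q : C) (n : nat) :
  eta_partial q (S n) = (eta_partial q n * (1 - q ^ S n))%C.
Proof. reflexivity. Qed.

(** For odd [j] the factors at [q] and [- q] multiply to [1 - q^(2j)], for even [j] they coincide.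
    The extra product in [q^4] supplies the even factors that complete the odd ones to a product in
    [q^2]; the lengths [n] and [2 n] make this exact. *)
Lemma eta_partial_opp (q : C) (n : nat) :
  (eta_partial q (2 * n) * eta_partial (- q) (2 * n) * eta_partial (q ^ 4) n =
   eta_partial (q ^ 2) n ^ 2 * eta_partial (q ^ 2) (2 * n))%C.
Proof.
  induction n as [|n IH].
  - simpl. ring.
  - replace (2 * S n)%nat with (S (S (2 * n))) by lia. rewrite !eta_partial_S.
    replace ((- q) ^ S (2 * n))%C with (- (q * q ^ (2 * n)))%C
      by (rewrite (Cpow_S (- q)), (Cpow_mult_r (- q)), (Cpow_mult_r q);
          replace ((- q) ^ 2)%C with (q ^ 2)%C by ring; ring).
    replace ((- q) ^ S (S (2 * n)))%C with (q * (q * q ^ (2 * n)))%C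
      by (change (S (S (2 * n))) with (2 + 2 * n)%nat;
          rewrite (Cpow_add_r (- q)), (Cpow_mult_r (- q)), (Cpow_mult_r q);
          replace ((- q) ^ 2)%C with (q ^ 2)%C by ring; ring).
    replace ((q ^ 2) ^ S n)%C with (q ^ 2 * q ^ (2 * n))%C
      by (rewrite <- !Cpow_add_r, <- Cpow_mult_r; f_equal; lia).
    replace ((q ^ 4) ^ S n)%C with (q ^ 4 * (q ^ (2 * n) * q ^ (2 * n)))%C
      by (rewrite <- !Cpow_add_r, <- Cpow_mult_r; f_equal; lia).
    replace ((q ^ 2) ^ S (2 * n))%C with (q ^ 2 * (q ^ (2 * n) * q ^ (2 * n)))%C
      by (rewrite <- !Cpow_add_r, <- Cpow_mult_r; f_equal; lia).
    replace ((q ^ 2) ^ S (S (2 * n)))%C with (q ^ 4 * (q ^ (2 * n) * q ^ (2 * n)))%C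
      by (rewrite <- !Cpow_add_r, <- Cpow_mult_r; f_equal; lia).
    rewrite (Cpow_S q (S (2 * n))), (Cpow_S q (2 * n)).
    set (x := (q ^ (2 * n))%C) in *.
    set (e1 := eta_partial q (2 * n)) in *. set (e2 := eta_partial (- q) (2 * n)) in *.
    set (e3 := eta_partial (q ^ 4) n) in *. set (e4 := eta_partial (q ^ 2) n) in *.
    set (e5 := eta_partial (q ^ 2) (2 * n)) in *.
    transitivity ((e1 * e2 * e3) * (1 - q * x) * (1 - q * (q * x)) *
      (1 - - (q * x)) * (1 - q * (q * x)) * (1 - q ^ 4 * (x * x)))%C; [ring|].
    rewrite IH. ring.
Qed.

Lemma Cmod_pow_le (q : C) (k : nat) : Cmod q <= 1/4 -> Cmod (q ^ S k) <= 1/4 /\ Cmod (q ^ S k) <= Cmod q.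
Proof.
  intros Hq. rewrite Cmod_pow. simpl. assert (H0 := Cmod_ge_0 q).
  assert (0 <= Cmod q ^ k <= 1).
  { split; [now apply pow_le|]. rewrite <- (pow1 k). apply pow_incr; lra. }
  split; nra.
Qed.

Lemma Ccv_pow (u : nat -> C) (l : C) (k : nat) : Ccv u l -> Ccv (fun n => u n ^ k)%C (l ^ k)%C.
Proof.
  intros H. induction k as [|k IH]; [apply Ccv_const | now apply Ccv_mult].
Qed.

Lemma eta_prod_cv_double (q : C) : Cmod q <= 1/4 -> Ccv (fun n => eta_partial q (2 * n)) (E q).
Proof.
  intros Hq. apply (Ccv_subseq (eta_partial q) (E q) (fun n => (2 * n)%nat)); [lia | now apply eta_prod_cv].
Qed.

Lemma eta_prod_opp (q : C) : Cmod q <= 1/4 -> (E q * E (- q) * E (q ^ 4) = E (q ^ 2) ^ 3)%C.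
Proof.
  intros Hq.
  destruct (Cmod_pow_le q 1 Hq) as [H2 _]. destruct (Cmod_pow_le q 3 Hq) as [H4 _].
  assert (Hm : Cmod (- q) <= 1/4) by now rewrite Cmod_opp.
  replace (E (q ^ 2) ^ 3)%C with (E (q ^ 2) ^ 2 * E (q ^ 2))%C by ring.
  apply Ccv_unique with (u := fun n => (eta_partial q (2 * n) * eta_partial (- q) (2 * n) * eta_partial (q ^ 4) n)%C).
  - apply Ccv_mult; [apply Ccv_mult|]; now (apply eta_prod_cv_double || apply eta_prod_cv).
  - apply Ccv_ext with (u := fun n => (eta_partial (q ^ 2) n ^ 2 * eta_partial (q ^ 2) (2 * n))%C);
      [intros n; symmetry; apply eta_partial_opp|].
    apply Ccv_mult; [apply Ccv_pow; now apply eta_prod_cv | now apply eta_prod_cv_double].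
Qed.

Lemma Ccv_inv (u : nat -> C) (l : C) : l <> 0 -> Ccv u l -> Ccv (fun n => / u n)%C (/ l)%C.
Proof.
  intros Hl [H1 H2].
  assert (D : Re l * (Re l * 1) + Im l * (Im l * 1) <> 0).
  { apply Cmod_gt_0 in Hl. assert (H := Cmod2_alt l).
    assert (0 < Cmod l ^ 2) by now apply pow_lt. simpl in *. lra. }
  split.
  - apply (is_lim_seq_div' (fun n => Re (u n))); trivial.
    repeat (apply is_lim_seq_plus' || apply is_lim_seq_mult' || apply is_lim_seq_const); trivial.
  - apply (is_lim_seq_div' (fun n => - Im (u n))); trivial.
    + now apply -> (is_lim_seq_opp (fun n => Im (u n)) (Im l)).
    + repeat (apply is_lim_seq_plus' || apply is_lim_seq_mult' || apply is_lim_seq_const); trivial.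
Qed.

(** * Gauss' theta series *)

Fixpoint theta_partial (q : C) (n : nat) : C :=
  match n with
  | O => RtoC 1
  | S m => (theta_partial q m + 2 * q ^ (S m * S m))%C
  end.

(** With [x = - q] this is the limit of [(x;x)_n / (-x;x)_n], the shape in which the finite identity
    delivers it; [theta_eta] relates it to the quotient of the overview. *)
Definition theta (q : C) : C := (E (- q) ^ 2 / E (q ^ 2))%C.

(** The symbol [(-x;x)_n]. *)
Fixpoint poch_plus (x : C) (n : nat) : C :=
  match n with
  | O => RtoC 1
  | S m => (poch_plus x m * (1 + x ^ S m))%C
  end.

(** With [y = - x^(n+1)] and the prefactor [(x;x)_n / (-x;x)_n] this sums to
    [1 + 2 sum_(s <= n) (-1)^s x^(s^2)], while its terms with [s >= 1] die out as [n] grows. *)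
Fixpoint shanks_sum (x : C) (m : nat) (y : C) : C :=
  match m with
  | O => RtoC 1
  | S k => (shanks_sum x k y + 2 * y ^ S k * poch_plus x k / eta_partial x (S k))%C
  end.

Lemma theta_partial_S (q : C) (n : nat) :
  theta_partial q (S n) = (theta_partial q n + 2 * q ^ (S n * S n))%C.
Proof. reflexivity. Qed.

Lemma poch_plus_S (x : C) (n : nat) : poch_plus x (S n) = (poch_plus x n * (1 + x ^ S n))%C.
Proof. reflexivity. Qed.

Lemma shanks_sum_S (x y : C) (m : nat) : shanks_sum x (S m) y =
  (shanks_sum x m y + 2 * y ^ S m * poch_plus x m / eta_partial x (S m))%C.
Proof. reflexivity. Qed.

Lemma poch_plus_eta (x : C) (n : nat) :
  (poch_plus x n * eta_partial x n = eta_partial (x ^ 2) n)%C.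
Proof.
  induction n as [|n IH]; [simpl; ring|].
  rewrite !eta_partial_S, <- IH. rewrite !poch_plus_S.
  replace ((x ^ 2) ^ S n)%C with (x ^ S n * x ^ S n)%C
    by (rewrite <- Cpow_add_r, <- Cpow_mult_r; f_equal; lia).
  simpl. ring.
Qed.

Lemma poch_plus_neq_0 (x : C) (n : nat) : Cmod x <= 1/4 -> poch_plus x n <> 0.
Proof.
  intros Hx H0. apply (eta_partial_neq_0 (x ^ 2) n); [now apply (Cmod_pow_le x 1)|].
  rewrite <- poch_plus_eta, H0. ring.
Qed.

Lemma one_minus_pow_neq_0 (x : C) (n : nat) : Cmod x <= 1/4 -> (1 - x ^ S n)%C <> 0.
Proof.
  intros Hx. apply near_1_neq_0. replace (1 - x ^ S n - 1)%C with (- x ^ S n)%C by ring.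
  rewrite Cmod_opp. destruct (Cmod_pow_le x n Hx). lra.
Qed.

(** Passing from [n] to [n + 1] in the Shanks identity replaces [y] by [x * y]. The weights are
    chosen so that only a boundary term survives; at [y = - x^(n+1)] they are the new factors of
    [eta_partial] and [poch_plus]. The boundary term and the new last summand then add up to
    [2 * y^(n+1)]. *)
Lemma shanks_functional (x y : C) (m : nat) : Cmod x <= 1/4 ->
  ((1 + y) * shanks_sum x m (x * y) - (1 - y) * shanks_sum x m y =
   2 * y ^ S m * poch_plus x m / eta_partial x m)%C.
Proof.
  intros Hx. induction m as [|m IH].
  - simpl. field.
  - rewrite !shanks_sum_S. rewrite !poch_plus_S. rewrite !eta_partial_S in *.
    assert (N1 := eta_partial_neq_0 x m Hx). assert (N2 := one_minus_pow_neq_0 x m Hx).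
    rewrite Cpow_mult_l. rewrite (Cpow_S y (S m)).
    set (b := poch_plus x m) in *. set (a := eta_partial x m) in *.
    set (p := (x ^ S m)%C) in *. set (r := (y ^ S m)%C) in *.
    transitivity ((1 + y) * shanks_sum x m (x * y) - (1 - y) * shanks_sum x m y +
      2 * r * b * ((1 + y) * p - (1 - y)) / (a * (1 - p)))%C; [field; now split|].
    rewrite IH. field. now split.
Qed.

Lemma shanks_identity (x : C) (n : nat) : Cmod x <= 1/4 ->
  theta_partial (- x) n = (eta_partial x n / poch_plus x n * shanks_sum x n (- x ^ S n))%C.
Proof.
  intros Hx. induction n as [|n IH].
  - simpl. field.
  - rewrite !theta_partial_S. rewrite IH. rewrite !poch_plus_S. rewrite eta_partial_S.
    rewrite !shanks_sum_S. rewrite eta_partial_S.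
    assert (F := shanks_functional x (- x ^ S n) n Hx).
    replace (- x ^ S (S n))%C with (x * (- x ^ S n))%C by (simpl; ring).
    assert (N1 := eta_partial_neq_0 x n Hx). assert (N2 := one_minus_pow_neq_0 x n Hx).
    assert (N3 := poch_plus_neq_0 x (S n) Hx). rewrite poch_plus_S in N3.
    assert (N4 := poch_plus_neq_0 x n Hx).
    assert (N5 : (1 + x ^ S n)%C <> 0) by (intros H; apply N3; rewrite H; ring).
    (* The signs agree because a number and its square have the same parity. *)
    assert (P1 : ((- x) ^ (S n * S n) = (- x ^ S n) ^ S n)%C).
    { rewrite Cpow_mult_r. replace ((- x) ^ S n)%C with ((-1) ^ S n * x ^ S n)%C
        by (rewrite <- Cpow_mult_l; f_equal; ring).
      replace (- x ^ S n)%C with ((-1) * x ^ S n)%C by ring.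
      rewrite !Cpow_mult_l. f_equal. rewrite <- Cpow_mult_r.
      assert (Q : forall k, (((-1) ^ (k * k) = (-1) ^ k)%C)).
      { induction k as [|k IHk]; [reflexivity|].
        replace (S k * S k)%nat with (k * k + (2 * k + 1))%nat by lia.
        rewrite !Cpow_add_r, IHk, Cpow_mult_r. replace ((-1) ^ 2)%C with (RtoC 1) by (simpl; ring).
        rewrite Cpow_1_l. simpl. ring. }
      apply Q. }
    rewrite P1, Cpow_mult_l.
    set (p := (x ^ S n)%C) in *.
    replace (1 - - p)%C with (1 + p)%C in F by ring.
    rewrite (Cpow_S (- p) n) in *.
    fold p. set (b := poch_plus x n) in *. set (a := eta_partial x n) in *.
    set (r := ((- p) ^ n)%C) in *.
    set (w := shanks_sum x n (x * - p)) in *. set (w' := shanks_sum x n (- p)) in *.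
    replace w' with (((1 + - p) * w - 2 * (- p * r) * b / a) / (1 + p))%C
      by (rewrite <- F; field; trivial).
    field. repeat split; trivial.
Qed.

Lemma poch_plus_bound (x : C) (n : nat) : Cmod x <= 1/4 -> Cmod (poch_plus x n) <= 2 ^ n.
Proof.
  intros Hx. induction n as [|n IH]; [simpl; rewrite Cmod_1; lra|].
  rewrite !poch_plus_S. rewrite Cmod_mult. simpl (2 ^ S n). rewrite Rmult_comm.
  apply Rmult_le_compat; trivial; try apply Cmod_ge_0.
  eapply Rle_trans; [apply Cmod_triangle|]. rewrite Cmod_1.
  destruct (Cmod_pow_le x n Hx). lra.
Qed.

Lemma Cmod_near_1 (z : C) (d : R) : Cmod (z - 1) <= d -> 1 - d <= Cmod z <= 1 + d.
Proof.
  intros H. split.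
  - assert (F := Cmod_triangle z (- (z - 1))). rewrite Cmod_opp in F.
    replace (z + - (z - 1))%C with (RtoC 1) in F by ring. rewrite Cmod_1 in F. lra.
  - assert (F := Cmod_triangle 1 (z - 1)).
    replace (1 + (z - 1))%C with z in F by ring. rewrite Cmod_1 in F. lra.
Qed.

(** The summand of index [k + 1] is at most [2 * |y| * (1/4)^k * 2^k * 3], the 3 bounding the
    inverse of [eta_partial]; the sum of [6 * |y| * (1/2)^k] gives the 12. *)
Lemma shanks_sum_bound (x y : C) (m : nat) : Cmod x <= 1/4 -> Cmod y <= 1/4 ->
  Cmod (shanks_sum x m y - 1) <= 12 * Cmod y * (1 - (1/2) ^ m).
Proof.
  intros Hx Hy. assert (H0 := Cmod_ge_0 y). induction m as [|m IH].
  - simpl. replace (1 - 1)%C with (RtoC 0) by ring. rewrite Cmod_0. lra.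
  - rewrite !shanks_sum_S.
    replace (shanks_sum x m y + 2 * y ^ S m * poch_plus x m / eta_partial x (S m) - 1)%C with
      ((shanks_sum x m y - 1) + 2 * y ^ S m * poch_plus x m / eta_partial x (S m))%C by ring.
    eapply Rle_trans; [apply Cmod_triangle|].
    assert (A : 1/3 <= Cmod (eta_partial x (S m))).
    { destruct (eta_partial_bound x (S m) Hx) as [F _]. apply Cmod_near_1 in F.
      assert (0 <= Cmod x) by apply Cmod_ge_0.
      assert (0 <= Cmod x ^ S m) by now apply pow_le. nra. }
    rewrite Cmod_div by now apply eta_partial_neq_0.
    rewrite !Cmod_mult, Cmod_pow, Cmod_R, Rabs_pos_eq by lra.
    assert (B := poch_plus_bound x m Hx).
    assert (I : / Cmod (eta_partial x (S m)) <= 3).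
    { replace 3 with (/ (1/3)) by field. apply Rinv_le_contravar; lra. }
    assert (X : Cmod y ^ S m <= Cmod y * (1/4) ^ m).
    { simpl. apply Rmult_le_compat_l; trivial. apply pow_incr; lra. }
    assert (Y : Cmod y ^ S m * Cmod (poch_plus x m) <= Cmod y * (1/2) ^ m).
    { replace ((1/2) ^ m) with ((1/4) ^ m * 2 ^ m) by (rewrite <- Rpow_mult_distr; f_equal; field).
      rewrite <- Rmult_assoc. apply Rmult_le_compat; trivial; [now apply pow_le | apply Cmod_ge_0]. }
    assert (Z : 0 <= Cmod y ^ S m * Cmod (poch_plus x m)).
    { apply Rmult_le_pos; [now apply pow_le | apply Cmod_ge_0]. }
    unfold Rdiv.
    assert (2 * Cmod y ^ S m * Cmod (poch_plus x m) * / Cmod (eta_partial x (S m)) <=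
            6 * (Cmod y * (1/2) ^ m)).
    { replace (6 * (Cmod y * (1/2) ^ m)) with (2 * (Cmod y * (1/2) ^ m) * 3) by ring.
      apply Rmult_le_compat; trivial; try lra.
      left; apply Rinv_0_lt_compat; lra. }
    simpl ((1 * / 2) ^ S m). lra.
Qed.

Lemma theta_partial_cv (q : C) : Cmod q <= 1/4 -> Ccv (theta_partial q) (theta q).
Proof.
  intros Hq. set (x := (- q)%C).
  assert (Hx : Cmod x <= 1/4) by (unfold x; now rewrite Cmod_opp).
  assert (Hx2 := proj1 (Cmod_pow_le x 1 Hx)).
  assert (H0 := Cmod_ge_0 x).
  replace (theta q) with (E x ^ 2 * / E (x ^ 2) * 1)%C.
  2: { unfold theta, Cdiv. fold x. rewrite Cmult_1_r. do 3 f_equal. unfold x. ring. }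
  apply Ccv_ext with (u := fun n => (eta_partial x n ^ 2 * / eta_partial (x ^ 2) n *
    shanks_sum x n (- x ^ S n))%C).
  - intros n. replace q with (- x)%C by (unfold x; ring).
    rewrite shanks_identity, <- poch_plus_eta by trivial.
    field. split; [now apply poch_plus_neq_0 | now apply eta_partial_neq_0].
  - apply Ccv_mult; [apply Ccv_mult|].
    + now apply Ccv_pow, eta_prod_cv.
    + apply Ccv_inv; [now apply eta_prod_neq_0 | now apply eta_prod_cv].
    + apply Ccv_ext with (u := fun n => ((shanks_sum x n (- x ^ S n) - 1) + 1)%C).
      { intros n. ring. }
      enough (L : Ccv (fun n => (shanks_sum x n (- x ^ S n) - 1) + 1)%C (0 + 1)%C)
        by (rewrite Cplus_0_l in L; exact L).
      apply Ccv_plus; [|apply Ccv_const].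
      apply Ccv_0 with (v := fun n => 12 * (1/4) ^ n).
      * intros n. eapply Rle_trans.
        -- apply shanks_sum_bound; trivial. rewrite Cmod_opp. now apply Cmod_pow_le.
        -- rewrite Cmod_opp, Cmod_pow.
           assert (A : 0 <= (1/2) ^ n) by (apply pow_le; lra).
           assert (B : Cmod x ^ S n <= (1/4) ^ n).
           { simpl. assert (Cmod x ^ n <= (1/4) ^ n) by (apply pow_incr; lra).
             assert (0 <= Cmod x ^ n) by now apply pow_le. nra. }
           assert (0 <= Cmod x ^ S n) by now apply pow_le. nra.
      * replace (Finite 0) with (Rbar_mult 12 0) by (simpl; f_equal; ring).
        apply is_lim_seq_scal_l, is_lim_seq_geom. rewrite Rabs_pos_eq; lra.
Qed.

(** Odd squares cancel, and [(2 s)^2 = 4 s^2] turns the even ones into powers of [q^4]. *)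
Lemma theta_partial_bisection (q : C) (n : nat) :
  (theta_partial q (2 * n) + theta_partial (- q) (2 * n) = 2 * theta_partial (q ^ 4) n)%C.
Proof.
  induction n as [|n IH]; [simpl; ring|].
  replace (2 * S n)%nat with (S (S (2 * n))) by lia. rewrite !theta_partial_S.
  set (k := (S (2 * n) * S (2 * n))%nat). set (j := (S (S (2 * n)) * S (S (2 * n)))%nat).
  assert (Ev : forall i, ((- q) ^ (2 * i) = q ^ (2 * i))%C).
  { intros i. rewrite !Cpow_mult_r. f_equal. ring. }
  assert (K : ((- q) ^ k = - q ^ k)%C).
  { unfold k. replace (S (2 * n) * S (2 * n))%nat with (S (2 * (2 * n * n + 2 * n))) by lia.
    rewrite !Cpow_S, Ev. ring. }
  assert (J : ((- q) ^ j = (q ^ 4) ^ (S n * S n))%C).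
  { rewrite <- Cpow_mult_r. unfold j.
    replace (S (S (2 * n)) * S (S (2 * n)))%nat with (2 * (2 * (S n * S n)))%nat by lia.
    rewrite Ev. f_equal. lia. }
  assert (J' : (q ^ j = (q ^ 4) ^ (S n * S n))%C).
  { rewrite <- Cpow_mult_r. f_equal. unfold j. lia. }
  transitivity ((theta_partial q (2 * n) + theta_partial (- q) (2 * n)) + 2 * q ^ k + 2 * (- q) ^ k
     + 2 * q ^ j + 2 * (- q) ^ j)%C; [simpl; ring|].
  rewrite IH, K, J, J'. simpl. ring.
Qed.

Lemma theta_bisection (q : C) : Cmod q <= 1/4 -> (theta q + theta (- q) = 2 * theta (q ^ 4))%C.
Proof.
  intros Hq. assert (Hm : Cmod (- q) <= 1/4) by now rewrite Cmod_opp.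
  apply Ccv_unique with (u := fun n => (theta_partial q (2 * n) + theta_partial (- q) (2 * n))%C).
  - apply Ccv_plus;
      [apply (Ccv_subseq (theta_partial q) _ (fun n => (2 * n)%nat))
      |apply (Ccv_subseq (theta_partial (- q)) _ (fun n => (2 * n)%nat))];
      try lia; now apply theta_partial_cv.
  - apply Ccv_ext with (u := fun n => (2 * theta_partial (q ^ 4) n)%C).
    + intros n. symmetry. apply theta_partial_bisection.
    + apply Ccv_mult; [apply Ccv_const | apply theta_partial_cv; now apply (Cmod_pow_le q 3)].
Qed.

Lemma theta_opp (q : C) : theta (- q) = (E q ^ 2 / E (q ^ 2))%C.
Proof.
  unfold theta. replace (- - q)%C with q by ring. replace ((- q) ^ 2)%C with (q ^ 2)%C by ring. reflexivity.
Qed.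

Lemma theta_eta (q : C) : Cmod q <= 1/4 ->
  (theta q * (E q ^ 2 * E (q ^ 4) ^ 2) = E (q ^ 2) ^ 5)%C.
Proof.
  intros Hq. unfold theta.
  assert (N := eta_prod_neq_0 (q ^ 2) (proj1 (Cmod_pow_le q 1 Hq))).
  transitivity ((E q * E (- q) * E (q ^ 4)) ^ 2 / E (q ^ 2))%C; [field; trivial|].
  rewrite eta_prod_opp by trivial. field. trivial.
Qed.

Lemma theta_mul_opp (q : C) : Cmod q <= 1/4 -> (theta q * theta (- q) = theta (- q ^ 2) ^ 2)%C.
Proof.
  intros Hq. assert (H2 := proj1 (Cmod_pow_le q 1 Hq)). assert (H4 := proj1 (Cmod_pow_le q 3 Hq)).
  assert (N1 := eta_prod_neq_0 q Hq). assert (N2 := eta_prod_neq_0 _ H2).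
  assert (N4 := eta_prod_neq_0 _ H4).
  rewrite !theta_opp. replace ((q ^ 2) ^ 2)%C with (q ^ 4)%C by ring.
  replace (theta q) with (E (q ^ 2) ^ 5 / (E q ^ 2 * E (q ^ 4) ^ 2))%C.
  - field. now repeat split.
  - rewrite <- theta_eta by trivial. field. now split.
Qed.

Lemma theta_partial_bound (q : C) (n : nat) : Cmod q <= 1/4 ->
  Cmod (theta_partial q (S n) - 1 - 2 * q) <= 4 * (Cmod q ^ 2 * (1 - Cmod q ^ n)).
Proof.
  intros Hq. assert (H0 := Cmod_ge_0 q). induction n as [|n IH].
  - simpl. replace (1 + 2 * (q * 1) - 1 - 2 * q)%C with (RtoC 0) by ring. rewrite Cmod_0. lra.
  - rewrite !theta_partial_S in *.
    match goal with |- Cmod ?z <= _ =>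
      replace z with ((theta_partial q n + 2 * q ^ (S n * S n) - 1 - 2 * q) + 2 * q ^ (S (S n) * S (S n)))%C
        by (simpl; ring) end.
    eapply Rle_trans; [apply Cmod_triangle|].
    eapply Rle_trans; [apply Rplus_le_compat_r, IH|].
    rewrite Cmod_mult, Cmod_pow, Cmod_R, Rabs_pos_eq by lra.
    replace (S (S n) * S (S n))%nat with (3 + n + (n * n + 3 * n + 1))%nat by lia.
    rewrite pow_add, (pow_add _ 3 n). 
    set (c := (n * n + 3 * n + 1)%nat).
    assert (A : 0 <= Cmod q ^ c <= 1).
    { split; [now apply pow_le|]. rewrite <- (pow1 c). apply pow_incr; lra. }
    assert (B : 0 <= Cmod q ^ n) by now apply pow_le.
    assert (D : Cmod q ^ 3 * Cmod q ^ n * Cmod q ^ c <= Cmod q ^ 3 * Cmod q ^ n).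
    { assert (0 <= Cmod q ^ 3 * Cmod q ^ n) by (apply Rmult_le_pos; trivial; now apply pow_le). nra. }
    assert (F : Cmod q ^ 3 * Cmod q ^ n <= 1/4 * (Cmod q ^ 2 * Cmod q ^ n)).
    { assert (0 <= Cmod q ^ 2 * Cmod q ^ n) by (apply Rmult_le_pos; trivial; now apply pow_le).
      simpl in *. nra. }
    assert (G : Cmod q ^ 2 * Cmod q ^ S n <= 1/4 * (Cmod q ^ 2 * Cmod q ^ n)).
    { simpl in *. lra. }
    assert (0 <= Cmod q ^ 2 * Cmod q ^ n) by (apply Rmult_le_pos; trivial; now apply pow_le).
    lra.
Qed.

(** The linear term is kept because [theta q - theta (- q)] will be divided by [4 * q]. *)
Lemma theta_near (q : C) : Cmod q <= 1/4 -> Cmod (theta q - (1 + 2 * q)) <= 4 * Cmod q ^ 2.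
Proof.
  intros Hq. assert (H0 := Cmod_ge_0 q).
  apply Ccv_bound with (u := fun n => theta_partial q (S n)).
  - intros n. replace (theta_partial q (S n) - (1 + 2 * q))%C with (theta_partial q (S n) - 1 - 2 * q)%C by ring.
    eapply Rle_trans; [now apply theta_partial_bound|].
    assert (0 <= Cmod q ^ n) by now apply pow_le. assert (0 <= Cmod q ^ 2) by now apply pow_le. nra.
  - apply (Ccv_subseq (theta_partial q) _ S); [lia | now apply theta_partial_cv].
Qed.

(** * Behaviour as q tends to 0 *)

(** [P q] holds for all sufficiently small [q <> 0]; the bound [1/4] keeps [q] where the product
    estimates apply. *)
Definition small (P : C -> Prop) : Prop :=
  exists r : R, 0 < r <= 1/4 /\ forall q : C, q <> 0 -> Cmod q <= r -> P q.

Definition bigO (f : C -> C) : Prop :=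
  exists K : R, 0 <= K /\ small (fun q => Cmod (f q) <= K * Cmod q).

Definition near_one (f : C -> C) : Prop := bigO (fun q => f q - 1)%C.

Lemma small_and (P Q : C -> Prop) : small P -> small Q -> small (fun q => P q /\ Q q).
Proof.
  intros [r [Hr HP]] [s [Hs HQ]]. exists (Rmin r s). split.
  - split; [apply Rmin_pos; lra|]. apply Rle_trans with (1 := Rmin_l r s); lra.
  - intros q Hq Hm. split; [apply HP | apply HQ]; trivial.
    + apply Rle_trans with (1 := Hm), Rmin_l.
    + apply Rle_trans with (1 := Hm), Rmin_r.
Qed.

Lemma small_disk (d : R) : 0 < d -> small (fun q => q <> 0 /\ Cmod q <= 1/4 /\ Cmod q <= d).
Proof.
  intros Hd. exists (Rmin d (1/4)). split.
  - split; [apply Rmin_pos; lra | apply Rmin_r].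
  - intros q Hq Hm. repeat split; trivial; apply Rle_trans with (1 := Hm); [apply Rmin_r | apply Rmin_l].
Qed.

Lemma small_imp (P Q : C -> Prop) :
  (forall q : C, q <> 0 -> Cmod q <= 1/4 -> P q -> Q q) -> small P -> small Q.
Proof.
  intros H [r [Hr HP]]. exists r. split; trivial. intros q Hq Hm. apply H; trivial; [lra | now apply HP].
Qed.

Lemma small_pow (k : nat) (P : C -> Prop) : small P -> small (fun q => P (q ^ S k)%C).
Proof.
  intros [r [Hr HP]]. exists r. split; trivial. intros q Hq Hm. apply HP.
  - now apply Cpow_nz.
  - apply Rle_trans with (2 := Hm). apply Cmod_pow_le. lra.
Qed.

Lemma small_opp (P : C -> Prop) : small P -> small (fun q => P (- q)%C).
Proof.
  intros [r [Hr HP]]. exists r. split; trivial. intros q Hq Hm. apply HP.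
  - intros H. apply Hq. replace q with (- - q)%C by ring. rewrite H. ring.
  - now rewrite Cmod_opp.
Qed.

Lemma bigO_pow (k : nat) (f : C -> C) : bigO f -> bigO (fun q => f (q ^ S k)%C).
Proof.
  intros [K [HK H]]. exists K. split; trivial.
  apply small_imp with (2 := small_pow k _ H). intros q Hq Hm Hf.
  apply Rle_trans with (1 := Hf). apply Rmult_le_compat_l; trivial. now apply Cmod_pow_le.
Qed.

Lemma bigO_opp (f : C -> C) : bigO f -> bigO (fun q => f (- q)%C).
Proof.
  intros [K [HK H]]. exists K. split; trivial.
  apply small_imp with (2 := small_opp _ H). intros q Hq Hm Hf. now rewrite Cmod_opp in Hf.
Qed.

Lemma bigO_ext (f g : C -> C) : small (fun q => f q = g q) -> bigO f -> bigO g.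
Proof.
  intros E [K [HK H]]. exists K. split; trivial.
  apply small_imp with (2 := small_and _ _ E H). intros q _ _ [F G]. now rewrite <- F.
Qed.

Lemma bigO_plus (f g : C -> C) : bigO f -> bigO g -> bigO (fun q => f q + g q)%C.
Proof.
  intros [K [HK H]] [L [HL G]]. exists (K + L). split; [lra|].
  apply small_imp with (2 := small_and _ _ H G). intros q _ _ [F F'].
  eapply Rle_trans; [apply Cmod_triangle|]. lra.
Qed.

Lemma bigO_scal (c : C) (f : C -> C) : bigO f -> bigO (fun q => c * f q)%C.
Proof.
  intros [K [HK H]]. exists (Cmod c * K). split; [apply Rmult_le_pos; trivial; apply Cmod_ge_0|].
  apply small_imp with (2 := H). intros q _ _ F. rewrite Cmod_mult, Rmult_assoc.
  apply Rmult_le_compat_l; trivial. apply Cmod_ge_0.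
Qed.

Lemma near_one_close (f : C -> C) (d : R) : 0 < d -> near_one f -> small (fun q => Cmod (f q - 1) <= d).
Proof.
  intros Hd [K [HK H]].
  assert (P : 0 < d / (K + 1)) by (apply Rdiv_lt_0_compat; lra).
  apply small_imp with (2 := small_and _ _ H (small_disk _ P)).
  intros q _ _ [F [_ [_ G]]]. apply Rle_trans with (1 := F).
  assert (H0 := Cmod_ge_0 q).
  apply Rle_trans with ((K + 1) * (d / (K + 1))); [|right; field; lra].
  apply Rmult_le_compat; lra.
Qed.

Lemma near_one_mult (f g : C -> C) : near_one f -> near_one g -> near_one (fun q => f q * g q)%C.
Proof.
  intros Hf Hg. assert (Hc := near_one_close f 1 Rlt_0_1 Hf).
  destruct Hf as [K [HK H]], Hg as [L [HL G]]. exists (K + 2 * L). split; [lra|].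
  apply small_imp with (2 := small_and _ _ Hc (small_and _ _ H G)).
  intros q _ _ [A [B D]]. assert (H0 := Cmod_ge_0 q). apply Cmod_near_1 in A.
  replace (f q * g q - 1)%C with ((f q - 1) + f q * (g q - 1))%C by ring.
  eapply Rle_trans; [apply Cmod_triangle|]. rewrite Cmod_mult.
  assert (Cmod (f q) * Cmod (g q - 1) <= 2 * (L * Cmod q)).
  { apply Rmult_le_compat; try apply Cmod_ge_0; lra. }
  lra.
Qed.

Lemma near_one_inv (f : C -> C) : near_one f -> near_one (fun q => / f q)%C.
Proof.
  intros Hf. assert (P : 0 < 1/2) by lra. assert (Hc := near_one_close f _ P Hf).
  destruct Hf as [K [HK H]]. exists (2 * K). split; [lra|].
  apply small_imp with (2 := small_and _ _ Hc H).
  intros q _ _ [A B]. assert (N : f q <> 0) by (apply near_1_neq_0; lra).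
  apply Cmod_near_1 in A.
  replace (/ f q - 1)%C with (- ((f q - 1) * / f q))%C by (field; trivial).
  rewrite Cmod_opp, Cmod_mult, Cmod_inv by trivial.
  assert (I : / Cmod (f q) <= 2).
  { replace 2 with (/ (1/2)) by field. apply Rinv_le_contravar; lra. }
  replace (2 * K * Cmod q) with (K * Cmod q * 2) by ring.
  apply Rmult_le_compat; trivial; [apply Cmod_ge_0|]. left; apply Rinv_0_lt_compat; lra.
Qed.

Lemma near_one_pow (k : nat) (f : C -> C) : near_one f -> near_one (fun q => f q ^ k)%C.
Proof.
  intros H. induction k as [|k IH]; [|now apply (near_one_mult f)].
  exists 0. split; [lra|]. apply small_imp with (2 := small_disk 1 Rlt_0_1). intros q _ _ _.
  simpl. replace (1 - 1)%C with (RtoC 0) by ring. rewrite Cmod_0. lra.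
Qed.

Lemma near_one_eta : near_one E.
Proof.
  exists (8/3). split; [lra|]. apply small_imp with (2 := small_disk 1 Rlt_0_1).
  intros q _ H _. now apply eta_prod_near_1.
Qed.

Lemma near_one_theta : near_one theta.
Proof.
  exists 3. split; [lra|]. apply small_imp with (2 := small_disk 1 Rlt_0_1).
  intros q _ H _. assert (F := theta_near q H). assert (H0 := Cmod_ge_0 q).
  replace (theta q - 1)%C with (theta q - (1 + 2 * q) + 2 * q)%C by ring.
  eapply Rle_trans; [apply Cmod_triangle|].
  rewrite Cmod_mult, Cmod_R, Rabs_pos_eq by lra. simpl in F. nra.
Qed.

(** Each iteration loses a factor 2, but [|q^2| <= |q| / 4] turns the bound [K * |q|] into half of
    itself. The hypothesis [bigO g] is essential: a nonzero constant satisfies the other one. *)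
Lemma squaring_contraction (g : C -> C) :
  bigO g -> small (fun q => Cmod (g q) <= 2 * Cmod (g (q ^ 2)%C)) -> small (fun q => g q = 0).
Proof.
  intros [K [HK H]] G. destruct (small_and _ _ H G) as [r [Hr F]]. exists r. split; trivial.
  intros q Hq Hm.
  assert (X : forall n (q : C), q <> 0 -> Cmod q <= r -> Cmod (g q) <= K * (1/2) ^ n).
  { intros n.
    assert (Y : forall q : C, q <> 0 -> Cmod q <= r -> Cmod (g q) <= K * (1/2) ^ n * Cmod q).
    { induction n as [|n IH]; intros p Hp Hpm.
      - simpl. rewrite Rmult_1_r. now apply F.
      - assert (H4 : Cmod p <= 1/4) by lra. assert (H0 := Cmod_ge_0 p).
        assert (W := proj2 (Cmod_pow_le p 1 H4)).
        assert (Z := IH (p ^ 2)%C (Cpow_nz p 2 Hp) (Rle_trans _ _ _ W Hpm)).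
        apply Rle_trans with (1 := proj2 (F p Hp Hpm)).
        rewrite Cmod_pow in Z. simpl in Z |- *.
        assert (0 <= K * (1/2) ^ n) by (apply Rmult_le_pos; trivial; apply pow_le; lra).
        assert (K * (1/2) ^ n * (Cmod p * (Cmod p * 1)) <= K * (1/2) ^ n * (Cmod p * (1/4))).
        { apply Rmult_le_compat_l; trivial. apply Rmult_le_compat_l; lra. }
        lra. }
    intros p Hp Hpm. apply Rle_trans with (1 := Y p Hp Hpm). rewrite <- Rmult_1_r.
    apply Rmult_le_compat_l; [|lra]. apply Rmult_le_pos; trivial; apply pow_le; lra. }
  apply Cmod_eq_0. apply Rle_antisym; [|apply Cmod_ge_0].
  assert (L : Rbar_le (Cmod (g q)) 0).
  { apply is_lim_seq_le with (u := fun _ => Cmod (g q)) (v := fun n => K * (1/2) ^ n).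
    - intros n. now apply X.
    - apply is_lim_seq_const.
    - replace (Finite 0) with (Rbar_mult K 0) by (simpl; f_equal; ring).
      apply is_lim_seq_scal_l, is_lim_seq_geom. rewrite Rabs_pos_eq; lra. }
  exact L.
Qed.

(** * Theta identities *)

(** Squaring [theta_bisection] and using [theta_mul_opp] for the cross term gives exactly
    [g q = - 2 * g (q ^ 2)] for the defect [g], just within the reach of [squaring_contraction]. *)
Lemma theta_sum_squares :
  small (fun q => (theta q ^ 2 + theta (- q) ^ 2 = 2 * theta (q ^ 2) ^ 2)%C).
Proof.
  set (g := fun q => (theta q ^ 2 + theta (- q) ^ 2 - 2 * theta (q ^ 2) ^ 2)%C).
  assert (G : small (fun q => g q = 0)).
  { apply squaring_contraction.
    - assert (N := near_one_pow 2 _ near_one_theta).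
      apply bigO_ext with (f := fun q => ((theta q ^ 2 - 1) + (theta (- q) ^ 2 - 1) +
        (-2) * (theta (q ^ 2) ^ 2 - 1))%C).
      + apply small_imp with (2 := small_disk 1 Rlt_0_1). intros q _ _ _. unfold g. ring.
      + apply bigO_plus; [apply bigO_plus; trivial|].
        * now apply (bigO_opp (fun q => theta q ^ 2 - 1)%C).
        * apply bigO_scal. now apply (bigO_pow 1 (fun q => theta q ^ 2 - 1)%C).
    - apply small_imp with (2 := small_disk 1 Rlt_0_1). intros q _ Hq _.
      replace (g q) with (- 2 * g (q ^ 2))%C.
      + rewrite Cmod_mult, Cmod_R, Rabs_left by lra. lra.
      + unfold g. replace ((q ^ 2) ^ 2)%C with (q ^ 4)%C by ring.
        transitivity ((2 * theta (q ^ 4)) ^ 2 - 2 * theta (- q ^ 2) ^ 2 - 2 * theta (q ^ 2) ^ 2)%C; [ring|].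
        rewrite <- theta_bisection, <- theta_mul_opp by trivial. ring. }
  apply small_imp with (2 := G). unfold g. intros q _ _ H.
  replace (theta q ^ 2 + theta (- q) ^ 2)%C with
    (theta q ^ 2 + theta (- q) ^ 2 - 2 * theta (q ^ 2) ^ 2 + 2 * theta (q ^ 2) ^ 2)%C by ring.
  rewrite H. ring.
Qed.

(** Gauss' product for the series over triangular numbers, [sum q^(n(n+1)/2)]. *)
Definition psi (q : C) : C := (E (q ^ 2) ^ 2 / E q)%C.

Lemma psi_square (q : C) : Cmod q <= 1/4 -> (psi q ^ 2 = theta q * psi (q ^ 2))%C.
Proof.
  intros Hq. assert (H2 := proj1 (Cmod_pow_le q 1 Hq)). assert (H4 := proj1 (Cmod_pow_le q 3 Hq)).
  assert (N1 := eta_prod_neq_0 q Hq). assert (N2 := eta_prod_neq_0 _ H2).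
  assert (N4 := eta_prod_neq_0 _ H4).
  unfold psi. replace ((q ^ 2) ^ 2)%C with (q ^ 4)%C by ring.
  transitivity (E (q ^ 2) ^ 5 / (E q ^ 2 * E (q ^ 2)))%C; [field; now split|].
  rewrite <- theta_eta by trivial. field; repeat split; trivial.
Qed.

(** This links the eta quotient [t] to theta functions. Divided by [8 * q], the two sides are [a]
    and [b], which tend to 1 and both satisfy [x(q)^2 = theta(q^4)^2 * x(q^2)]. As this relation is
    quadratic, the difference contracts only after division by [a + b], which is close to 2. *)
Lemma theta_diff_squares :
  small (fun q => (theta q ^ 2 - theta (- q) ^ 2 = 8 * q * psi (q ^ 4) ^ 2)%C).
Proof.
  set (a := fun q => ((theta q - theta (- q)) / (4 * q) * theta (q ^ 4))%C).
  set (b := fun q => (psi (q ^ 4) ^ 2)%C).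
  assert (Na : near_one a).
  { apply near_one_mult; [|exact (bigO_pow 3 _ near_one_theta)].
    exists 2. split; [lra|]. apply small_imp with (2 := small_disk 1 Rlt_0_1). intros q Hq H _.
    assert (Hm : Cmod (- q) <= 1/4) by now rewrite Cmod_opp.
    assert (F := theta_near q H). assert (G := theta_near (- q) Hm). rewrite Cmod_opp in G.
    assert (P : 0 < Cmod q) by now apply Cmod_gt_0.
    assert (N4 : RtoC 4 <> 0) by (apply Cmod_gt_0; rewrite Cmod_R, Rabs_pos_eq; lra).
    replace ((theta q - theta (- q)) / (4 * q) - 1)%C with
      (((theta q - (1 + 2 * q)) + - (theta (- q) - (1 + 2 * - q))) / (4 * q))%C by (field; repeat split; trivial).
    rewrite Cmod_div by now apply Cmult_neq_0.
    rewrite Cmod_mult, Cmod_R, (Rabs_pos_eq 4) by lra.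
    apply Rle_trans with ((8 * Cmod q ^ 2) / (4 * Cmod q)); [|right; field; lra].
    apply Rmult_le_compat_r; [left; apply Rinv_0_lt_compat; lra|].
    eapply Rle_trans; [apply Cmod_triangle|]. rewrite Cmod_opp. lra. }
  assert (Nb : near_one b).
  { apply near_one_pow. apply (bigO_pow 3 (fun q => psi q - 1)%C).
    apply near_one_mult; [|exact (near_one_inv _ near_one_eta)].
    apply near_one_pow. exact (bigO_pow 1 _ near_one_eta). }
  assert (Hu : small (fun q => (theta q ^ 2 - theta (- q) ^ 2 = 8 * q * a q)%C)).
  { apply small_imp with (2 := small_disk 1 Rlt_0_1). intros q Hq H _. unfold a.
    assert (B := theta_bisection q H).
    assert (N4 : RtoC 4 <> 0) by (apply Cmod_gt_0; rewrite Cmod_R, Rabs_pos_eq; lra).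
    transitivity ((theta q - theta (- q)) * (theta q + theta (- q)))%C; [ring|].
    rewrite B. field; repeat split; trivial. }
  assert (G : small (fun q => (a q - b q = 0)%C)).
  { apply squaring_contraction.
    - apply bigO_ext with (f := fun q => ((a q - 1) + (-1) * (b q - 1))%C).
      + apply small_imp with (2 := small_disk 1 Rlt_0_1). intros q _ _ _. ring.
      + apply bigO_plus; trivial. now apply bigO_scal.
    - assert (P : 0 < 1/4) by lra.
      assert (Nt : near_one (fun q => theta (q ^ 4) ^ 2)%C).
      { apply near_one_pow. exact (bigO_pow 3 _ near_one_theta). }
      apply small_imp with (2 := small_and _ _ (small_and _ _ Hu (small_pow 1 _ Hu))
        (small_and _ _ (small_and _ _ theta_sum_squares (small_pow 1 _ theta_sum_squares))
        (small_and _ _ (near_one_close _ _ P Na)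
        (small_and _ _ (near_one_close _ _ P Nb) (near_one_close _ _ P Nt))))).
      intros q Hq H [[U U2] [[S1 S2] [Ca [Cb Ct]]]].
      assert (M := theta_mul_opp q H).
      assert (H4 := proj1 (Cmod_pow_le q 3 H)).
      assert (B := psi_square _ H4).
      replace ((q ^ 2) ^ 2)%C with (q ^ 4)%C in * by ring.
      set (x := a q) in *. set (y := b q) in *. set (x' := a (q ^ 2)%C) in *. set (y' := b (q ^ 2)%C) in *.
      assert (By : (y ^ 2 = theta (q ^ 4) ^ 2 * y')%C).
      { unfold y, y', b. replace ((q ^ 2) ^ 4)%C with ((q ^ 4) ^ 2)%C by ring. rewrite B. ring. }
      assert (N64 : (64 * q ^ 2)%C <> 0).
      { apply Cmult_neq_0; [apply Cmod_gt_0; rewrite Cmod_R, Rabs_pos_eq; lra | now apply Cpow_nz]. }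
      (* [(A - B)^2 = (A + B)^2 - 4 * A * B] for [A = theta q ^ 2] and [B = theta (- q) ^ 2], whose
         sum and product are known in terms of [q^2]. *)
      assert (Bx : (64 * q ^ 2 * x ^ 2 = 64 * q ^ 2 * (theta (q ^ 4) ^ 2 * x'))%C).
      { transitivity ((8 * q * x) ^ 2)%C; [ring|]. rewrite <- U.
        transitivity ((theta q ^ 2 + theta (- q) ^ 2) ^ 2 - 4 * (theta q * theta (- q)) ^ 2)%C; [ring|].
        rewrite S1, M.
        transitivity (4 * ((theta (q ^ 2) ^ 2 - theta (- q ^ 2) ^ 2) *
          (theta (q ^ 2) ^ 2 + theta (- q ^ 2) ^ 2)))%C; [ring|].
        rewrite S2, U2. ring. }
      assert (Bx' : (x ^ 2 = theta (q ^ 4) ^ 2 * x')%C).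
      { replace (x ^ 2)%C with (64 * q ^ 2 * x ^ 2 / (64 * q ^ 2))%C by (field; trivial).
        rewrite Bx. field; trivial. }
      assert (F : ((x + y) * (x - y) = theta (q ^ 4) ^ 2 * (x' - y'))%C).
      { transitivity (x ^ 2 - y ^ 2)%C; [ring|]. rewrite Bx', By. ring. }
      (* With [x] and [y] within 1/4 of 1, and [theta (q ^ 4) ^ 2] of modulus at most 5/4, the
         resulting factor is at most 5/4, below the allowed 2. *)
      assert (T1 : 1 <= Cmod (x + y)).
      { assert (T := Cmod_triangle (x + y) (- ((x - 1) + (y - 1)))). rewrite Cmod_opp in T.
        assert (T' := Cmod_triangle (x - 1) (y - 1)).
        replace (x + y + - (x - 1 + (y - 1)))%C with (RtoC 2) in T by ring.
        rewrite Cmod_R, Rabs_pos_eq in T by lra. lra. }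
      apply Cmod_near_1 in Ct.
      apply (f_equal Cmod) in F. rewrite !Cmod_mult in F.
      assert (0 <= Cmod (x - y)) by apply Cmod_ge_0.
      assert (0 <= Cmod (x' - y')) by apply Cmod_ge_0.
      rewrite Cmod_pow in Ct. rewrite Cmod_pow in F. nra. }
  apply small_imp with (2 := small_and _ _ Hu G). intros q _ _ [U V]. rewrite U.
  fold (b q). replace (a q) with (a q - b q + b q)%C by ring. rewrite V. ring.
Qed.

(** * Complex power series *)

Lemma Cseries_unique (a : nat -> C) (l l' : C) : is_series a l -> is_series a l' -> l = l'.
Proof. intros H H'. exact (filterlim_locally_unique _ _ _ H H'). Qed.

Lemma Cseries_bound (a : nat -> C) (b : nat -> R) (l : C) (B : R) :
  (forall n, Cmod (a n) <= b n) -> is_series a l -> is_series b B -> Cmod l <= B.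
Proof.
  intros H Ha Hb.
  assert (L : Rbar_le (Cmod l) B).
  { apply is_lim_seq_le with (u := fun n => Cmod (sum_n a n)) (v := sum_n b).
    - intros n. induction n as [|n IH].
      + rewrite !sum_O. apply H.
      + rewrite !sum_Sn. eapply Rle_trans; [apply Cmod_triangle|]. now apply Rplus_le_compat.
    - apply (filterlim_comp _ _ _ (sum_n a) (fun z : C => norm z) _ _ _ Ha).
      apply (filterlim_norm (K := C_AbsRing) (V := C_NormedModule)).
    - exact Hb. }
  exact L.
Qed.

Lemma Cseries_plus (a b : nat -> C) (l m : C) :
  is_series a l -> is_series b m -> is_series (fun n => a n + b n)%C (l + m)%C.
Proof. intros Ha Hb. exact (is_series_plus (V := C_NormedModule) a b l m Ha Hb). Qed.

Lemma Cseries_scal (c : C) (a : nat -> C) (l : C) :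
  is_series a l -> is_series (fun n => c * a n)%C (c * l)%C.
Proof. intros Ha. exact (is_series_scal (V := C_NormedModule) c a l Ha). Qed.

Lemma Cseries_shift (a : nat -> C) (l : C) : a 0%nat = 0 ->
  is_series (fun n => a (S n)) l -> is_series a l.
Proof.
  intros H0 Ha. apply (is_series_decr_1 (V := C_NormedModule)). rewrite H0.
  assert (X : (l + Copp (RtoC 0))%C = l) by ring.
  exact (eq_ind_r (fun m => is_series (fun n => a (S n)) m) Ha X).
Qed.

Lemma Cseries_ext (a b : nat -> C) (l : C) :
  (forall n, a n = b n) -> is_series a l -> is_series b l.
Proof. exact (is_series_ext (V := C_NormedModule) a b l). Qed.

Definition cpower (a : nat -> R) (z : C) : C :=
  iota (T := C_CompleteNormedModule) (fun l => is_series (V := C_NormedModule) (fun n => RtoC (a n) * z ^ n)%C l).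

(** The rate 64 is twice the bound 32 for [P], which leaves room for the factor [n + 1] of a
    derivative. On the disk of radius 1/256 the series then has ratio 1/4. *)
Definition geometric (a : nat -> R) : Prop :=
  exists M : R, 0 <= M /\ forall n, Rabs (a n) <= M * 64 ^ n.

Lemma geom_scal_series (M r : R) : 0 <= r < 1 -> is_series (fun n => M * r ^ n) (M * / (1 - r)).
Proof.
  intros H. apply (is_series_scal (K := R_AbsRing) (V := R_NormedModule) M (fun n => r ^ n)).
  apply is_series_geom. rewrite Rabs_pos_eq; lra.
Qed.

Lemma cpower_correct (a : nat -> R) (z : C) : geometric a -> Cmod z <= 1/256 ->
  is_series (fun n => RtoC (a n) * z ^ n)%C (cpower a z).
Proof.
  intros [M [HM Ha]] Hz. unfold cpower. apply (iota_correct (V := C_CompleteNormedModule)).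
  assert (X : ex_series (V := C_NormedModule) (fun n => RtoC (a n) * z ^ n)%C).
  { apply (ex_series_le (V := C_CompleteNormedModule)) with (b := fun n => M * (1/4) ^ n).
    - intros n. change (Cmod (a n * z ^ n) <= M * (1/4) ^ n).
      rewrite Cmod_mult, Cmod_R, Cmod_pow.
      replace ((1/4) ^ n) with (64 ^ n * (1/256) ^ n) by (rewrite <- Rpow_mult_distr; f_equal; field).
      rewrite <- Rmult_assoc. apply Rmult_le_compat; trivial.
      + apply Rabs_pos.
      + apply pow_le, Cmod_ge_0.
      + apply pow_incr. split; trivial. apply Cmod_ge_0.
    - exists (M * / (1 - 1/4)). apply geom_scal_series. lra. }
  destruct X as [l Hl]. exists l. split; trivial. intros l' Hl'. exact (Cseries_unique _ _ _ Hl Hl').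
Qed.

Lemma cpower_eq (a : nat -> R) (z l : C) : geometric a -> Cmod z <= 1/256 ->
  is_series (fun n => RtoC (a n) * z ^ n)%C l -> cpower a z = l.
Proof. intros Ha Hz H. exact (Cseries_unique _ _ _ (cpower_correct a z Ha Hz) H). Qed.

Definition shift (a : nat -> R) (n : nat) : R := match n with O => 0 | S m => a m end.

Definition deriv_coef (a : nat -> R) (n : nat) : R := INR (S n) * a (S n).

Lemma geometric_shift (a : nat -> R) : geometric a -> geometric (shift a).
Proof.
  intros [M [HM H]]. exists M. split; trivial. intros [|n].
  - simpl. rewrite Rabs_R0. lra.
  - simpl shift. apply Rle_trans with (1 := H n). apply Rmult_le_compat_l; trivial.
    apply Rle_pow; [lra | lia].
Qed.

Lemma geometric_lin (a b : nat -> R) (c : R) : geometric a -> geometric b ->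
  geometric (fun n => a n + c * b n).
Proof.
  intros [M [HM H]] [L [HL G]]. exists (M + Rabs c * L). split.
  - assert (0 <= Rabs c * L) by (apply Rmult_le_pos; trivial; apply Rabs_pos). lra.
  - intros n. eapply Rle_trans; [apply Rabs_triang|]. rewrite Rabs_mult, Rmult_plus_distr_r.
    apply Rplus_le_compat; trivial. rewrite Rmult_assoc. apply Rmult_le_compat_l; trivial. apply Rabs_pos.
Qed.

Lemma geometric_ext (a b : nat -> R) : (forall n, a n = b n) -> geometric a -> geometric b.
Proof. intros E [M [HM H]]. exists M. split; trivial. intros n. now rewrite <- E. Qed.

Lemma cpower_ext (a b : nat -> R) (z : C) : geometric a -> Cmod z <= 1/256 ->
  (forall n, a n = b n) -> cpower b z = cpower a z.
Proof.
  intros Ha Hz E. apply cpower_eq; trivial; [now apply geometric_ext with a|].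
  apply Cseries_ext with (fun n => RtoC (a n) * z ^ n)%C; [intros n; now rewrite E|].
  now apply cpower_correct.
Qed.

Lemma cpower_lin (a b : nat -> R) (c : R) (z : C) : geometric a -> geometric b -> Cmod z <= 1/256 ->
  cpower (fun n => a n + c * b n) z = (cpower a z + c * cpower b z)%C.
Proof.
  intros Ha Hb Hz. apply cpower_eq; trivial; [now apply geometric_lin|].
  apply Cseries_ext with (fun n => RtoC (a n) * z ^ n + c * (RtoC (b n) * z ^ n))%C.
  - intros n. rewrite RtoC_plus, RtoC_mult. ring.
  - apply Cseries_plus; [|apply Cseries_scal]; now apply cpower_correct.
Qed.

Lemma cpower_shift (a : nat -> R) (z : C) : geometric a -> Cmod z <= 1/256 ->
  cpower (shift a) z = (z * cpower a z)%C.
Proof.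
  intros Ha Hz. apply cpower_eq; trivial; [now apply geometric_shift|].
  apply Cseries_shift; [simpl; ring|].
  apply Cseries_ext with (fun n => z * (RtoC (a n) * z ^ n))%C; [intros n; simpl; ring|].
  now apply Cseries_scal, cpower_correct.
Qed.

(** * Termwise differentiation of power series *)

Definition vanishes (k : nat) (f : C -> C) : Prop :=
  exists K r : R, 0 <= K /\ 0 < r <= 1 /\ forall h : C, Cmod h <= r -> Cmod (f h) <= K * Cmod h ^ k.

(** The remainder is required to be quadratic, which is stronger than differentiability but
    holds for analytic functions and makes the calculus rules elementary. *)
Definition Cderiv (f : C -> C) (z d : C) : Prop :=
  vanishes 2 (fun h => f (z + h) - f z - d * h)%C.

(** The remainder [(z + h)^n - z^n - n * z^(n-1) * h], in a recursive form that needs no predecessor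
    and suits estimates by induction. *)
Fixpoint taylor_rem (z h : C) (n : nat) : C :=
  match n with
  | O => RtoC 0
  | S m => (z * taylor_rem z h m + h * ((z + h) ^ m - z ^ m))%C
  end.

Lemma taylor_rem_0 (z h : C) (n : nat) :
  taylor_rem z h (S n) = ((z + h) ^ S n - z ^ S n - h * (INR (S n) * z ^ n))%C.
Proof.
  induction n as [|n IH]; [simpl; ring|].
  change (taylor_rem z h (S (S n))) with (z * taylor_rem z h (S n) + h * ((z + h) ^ S n - z ^ S n))%C.
  rewrite IH, (S_INR (S n)), RtoC_plus. rewrite !Cpow_S. ring.
Qed.

(** The factor [2^n] is a crude replacement for [n], and in [taylor_rem_bound] for [n (n-1) / 2];
    its price is a factor 2 in the ratio of the series. *)
Lemma pow_diff_bound (z h : C) (r : R) (n : nat) : 0 < r -> Cmod z <= r -> Cmod (z + h)%C <= r ->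
  Cmod ((z + h) ^ n - z ^ n)%C <= Cmod h * ((2 * r) ^ n / r).
Proof.
  intros Hr Hz Hzh. assert (H0 := Cmod_ge_0 h). induction n as [|n IH].
  - simpl. replace (1 - 1)%C with (RtoC 0) by ring. rewrite Cmod_0.
    apply Rmult_le_pos; trivial. left. apply Rdiv_lt_0_compat; lra.
  - rewrite !Cpow_S.
    replace ((z + h) * (z + h) ^ n - z * z ^ n)%C with ((z + h) * ((z + h) ^ n - z ^ n) + h * z ^ n)%C by ring.
    eapply Rle_trans; [apply Cmod_triangle|]. rewrite !Cmod_mult, Cmod_pow.
    assert (A : Cmod (z + h) * Cmod ((z + h) ^ n - z ^ n) <= r * (Cmod h * ((2 * r) ^ n / r))).
    { apply Rmult_le_compat; trivial; apply Cmod_ge_0. }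
    assert (B : Cmod z ^ n <= (2 * r) ^ n).
    { apply pow_incr. split; [apply Cmod_ge_0 | lra]. }
    assert (D : Cmod h * Cmod z ^ n <= Cmod h * (2 * r) ^ n) by now apply Rmult_le_compat_l.
    replace (Cmod h * ((2 * r) ^ S n / r)) with (r * (Cmod h * ((2 * r) ^ n / r)) + Cmod h * (2 * r) ^ n).
    + lra.
    + simpl. field. lra.
Qed.

Lemma taylor_rem_bound (z h : C) (r : R) (n : nat) : 0 < r -> Cmod z <= r -> Cmod (z + h)%C <= r ->
  Cmod (taylor_rem z h n) <= Cmod h ^ 2 * ((2 * r) ^ n / r ^ 2).
Proof.
  intros Hr Hz Hzh. assert (H0 := Cmod_ge_0 h).
  induction n as [|n IH].
  - simpl taylor_rem. rewrite Cmod_0. apply Rmult_le_pos; [now apply pow_le|].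
    left. apply Rdiv_lt_0_compat; apply pow_lt; lra.
  - simpl taylor_rem. eapply Rle_trans; [apply Cmod_triangle|]. rewrite !Cmod_mult.
    assert (A : Cmod z * Cmod (taylor_rem z h n) <= r * (Cmod h ^ 2 * ((2 * r) ^ n / r ^ 2))).
    { apply Rmult_le_compat; trivial; apply Cmod_ge_0. }
    assert (B := pow_diff_bound z h r n Hr Hz Hzh).
    assert (D : Cmod h * Cmod ((z + h) ^ n - z ^ n) <= Cmod h * (Cmod h * ((2 * r) ^ n / r)))
      by now apply Rmult_le_compat_l.
    replace (Cmod h ^ 2 * ((2 * r) ^ S n / r ^ 2)) with
      (r * (Cmod h ^ 2 * ((2 * r) ^ n / r ^ 2)) + Cmod h * (Cmod h * ((2 * r) ^ n / r))).
    + lra.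
    + simpl. field. lra.
Qed.

Lemma cpower_deriv (a : nat -> R) (z : C) : geometric a -> geometric (deriv_coef a) ->
  Cmod z < 1/256 -> Cderiv (cpower a) z (cpower (deriv_coef a) z).
Proof.
  intros Ha Hd Hz. set (r := 1/256) in *.
  assert (Ha' := Ha). destruct Ha' as [M [HM Hb]].
  (* Since [64 * (2 * r) = 1/2], the remainders are dominated by a geometric series of ratio 1/2;
     the radius [r - |z|] keeps [z + h] in the disk of convergence. *)
  exists (M / r ^ 2 * / (1 - 1/2)), (r - Cmod z). unfold r. assert (H0 := Cmod_ge_0 z). split; [|split].
  - apply Rmult_le_pos; [|lra]. apply Rmult_le_pos; lra.
  - unfold r in Hz. lra.
  - intros h Hh. fold r in Hh |- *.
    assert (Hzh : Cmod (z + h) <= r) by (eapply Rle_trans; [apply Cmod_triangle|]; lra).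
    assert (Hz' : Cmod z <= r) by lra. assert (Hr : 0 < r) by (unfold r; lra).
    replace (M / r ^ 2 * / (1 - 1 / 2) * Cmod h ^ 2) with ((M * Cmod h ^ 2 / r ^ 2) * / (1 - 1/2))
      by (field; lra).
    apply Cseries_bound with (a := fun n => (a n * taylor_rem z h n)%C)
      (b := fun n => M * Cmod h ^ 2 / r ^ 2 * (1/2) ^ n).
    + intros n. rewrite Cmod_mult, Cmod_R.
      apply Rle_trans with (M * 64 ^ n * (Cmod h ^ 2 * ((2 * r) ^ n / r ^ 2))).
      * apply Rmult_le_compat; trivial; [apply Rabs_pos | apply Cmod_ge_0 | now apply taylor_rem_bound].
      * right. replace ((1/2) ^ n) with (64 ^ n * (2 * r) ^ n)
          by (rewrite <- Rpow_mult_distr; f_equal; unfold r; field).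
        field. lra.
    + replace (cpower a (z + h) - cpower a z - cpower (deriv_coef a) z * h)%C with
        (cpower a (z + h) + (- (1) * cpower a z + - h * cpower (deriv_coef a) z))%C by ring.
      apply Cseries_ext with (fun n => a n * (z + h) ^ n + (- (1) * (a n * z ^ n) +
        - h * match n with O => RtoC 0 | S m => deriv_coef a m * z ^ m end))%C.
      * intros [|n]; [simpl; ring|].
        rewrite taylor_rem_0. unfold deriv_coef. rewrite RtoC_mult. ring.
      * apply Cseries_plus; [now apply cpower_correct|].
        apply Cseries_plus; apply Cseries_scal; [now apply cpower_correct|].
        apply Cseries_shift; [reflexivity|]. now apply cpower_correct.
    + apply geom_scal_series. lra.
Qed.

(** * The differential equation *)

(** The triangle inequality in the recurrence asks for [24 * 32 + 128 <= 32^2]. *)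
Lemma CLF_bound (P : nat -> R) (n : nat) : is_CLF P -> Rabs (P n) <= 32 ^ n.
Proof.
  intros [P0 [P1 Hrec]].
  enough (F : Rabs (P n) <= 32 ^ n /\ Rabs (P (S n)) <= 32 ^ S n) by apply F.
  induction n as [|n [IH1 IH2]].
  - rewrite P0, P1, !Rabs_pos_eq by lra. simpl. lra.
  - split; trivial. assert (H2 : (2 <= S (S n))%nat) by lia.
    assert (R := Hrec _ H2). replace (S (S n) - 1)%nat with (S n) in R by lia.
    replace (S (S n) - 2)%nat with n in R by lia.
    assert (N2 : 2 <= INR (S (S n))) by (apply (le_INR 2); lia).
    set (N := INR (S (S n))) in *.
    apply Rmult_le_reg_l with (N ^ 2); [apply pow_lt; lra|].
    rewrite <- (Rabs_pos_eq (N ^ 2)) at 1 by (apply pow_le; lra). rewrite <- Rabs_mult.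
    replace (N ^ 2 * P (S (S n))) with
      (8 * (3 * N ^ 2 - 3 * N + 1) * P (S n) + - (128 * (N - 1) ^ 2 * P n)) by lra.
    eapply Rle_trans; [apply Rabs_triang|]. rewrite Rabs_Ropp, !(Rabs_mult (_ * _)).
    rewrite (Rabs_pos_eq (8 * _)) by nra. rewrite (Rabs_pos_eq (128 * _)) by nra.
    assert (A : 8 * (3 * N ^ 2 - 3 * N + 1) * Rabs (P (S n)) <= 24 * N ^ 2 * 32 ^ S n).
    { apply Rmult_le_compat; trivial; try apply Rabs_pos; nra. }
    assert (B : 128 * (N - 1) ^ 2 * Rabs (P n) <= 128 * N ^ 2 * 32 ^ n).
    { apply Rmult_le_compat; trivial; try apply Rabs_pos; nra. }
    assert (0 < 32 ^ n) by (apply pow_lt; lra).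
    assert (0 < N ^ 2 * 32 ^ n) by (apply Rmult_lt_0_compat; trivial; nra).
    simpl (32 ^ S (S n)). simpl (32 ^ S n) in A. nra.
Qed.

Lemma CLF_geometric (P : nat -> R) : is_CLF P -> geometric P.
Proof.
  intros HP. exists 1. split; [lra|]. intros n. rewrite Rmult_1_l.
  apply Rle_trans with (1 := CLF_bound P n HP). apply pow_incr. lra.
Qed.

Lemma CLF_deriv_geometric (P : nat -> R) : is_CLF P -> geometric (deriv_coef P).
Proof.
  intros HP. exists 32. split; [lra|]. intros n. unfold deriv_coef.
  rewrite Rabs_mult, (Rabs_pos_eq (INR _)) by apply pos_INR.
  assert (A : INR (S n) <= 2 ^ n).
  { induction n as [|n IH]; [simpl; lra|]. rewrite S_INR. simpl (2 ^ S n).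
    assert (1 <= 2 ^ n) by (apply pow_R1_Rle; lra). lra. }
  replace (32 * 64 ^ n) with (2 ^ n * 32 ^ S n).
  - apply Rmult_le_compat; trivial; [apply pos_INR | apply Rabs_pos | now apply CLF_bound].
  - simpl. replace (64 ^ n) with (2 ^ n * 32 ^ n) by (rewrite <- Rpow_mult_distr; f_equal; ring). ring.
Qed.

(** Coefficients of [z (1 - 8 z) (1 - 16 z) G'(z)], whose derivative is [8 (1 - 16 z) G(z)]. *)
Definition flux_coef (P : nat -> R) : nat -> R :=
  let d := deriv_coef P in
  shift (fun n => (d n + (-24) * shift d n) + 128 * shift (shift d) n).

(** The recurrence in divergence form: taken at [n + 1], its coefficients split by
    [3 n^2 + 3 n + 1 = 3 n (n+1) + 1] and [n^2 = (n+1)(n-1) + 1]; the multiples of [n + 1] form the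
    derivative. *)
Lemma flux_coef_deriv (P : nat -> R) (n : nat) : is_CLF P ->
  8 * P n + (-128) * shift P n = deriv_coef (flux_coef P) n.
Proof.
  intros [P0 [P1 Hrec]]. unfold deriv_coef at 1, flux_coef, shift, deriv_coef.
  (* The recurrence starts at index 2, so [n = 0] rests on the initial values [P 1 = 8 * P 0]. *)
  destruct n as [|[|n]].
  - rewrite P0, P1. simpl. ring.
  - assert (R := Hrec 2%nat (le_n 2)). simpl in R |- *. rewrite P0, P1 in *. lra.
  - assert (H2 : (2 <= S (S (S n)))%nat) by lia.
    assert (R := Hrec _ H2). replace (S (S (S n)) - 1)%nat with (S (S n)) in R by lia.
    replace (S (S (S n)) - 2)%nat with (S n) in R by lia.
    rewrite (S_INR (S (S n))), (S_INR (S n)), (S_INR n) in *. lra.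
Qed.

Definition clf_weight (z : C) : C := (z * (1 - 8 * z) * (1 - 16 * z))%C.

Lemma flux_geometric (P : nat -> R) : is_CLF P -> geometric (flux_coef P).
Proof.
  intros HP. assert (G := CLF_deriv_geometric P HP). unfold flux_coef.
  apply geometric_shift. apply geometric_lin; [apply geometric_lin|]; trivial; repeat apply geometric_shift; trivial.
Qed.

Lemma flux_eq (P : nat -> R) (z : C) : is_CLF P -> Cmod z <= 1/256 ->
  cpower (flux_coef P) z = (clf_weight z * cpower (deriv_coef P) z)%C.
Proof.
  intros HP Hz. assert (G := CLF_deriv_geometric P HP). assert (G1 := geometric_shift _ G).
  assert (G2 := geometric_shift _ G1).
  unfold flux_coef. rewrite cpower_shift; trivial.
  2: { apply geometric_lin; trivial. now apply geometric_lin. }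
  rewrite (cpower_lin (fun n => deriv_coef P n + (-24) * shift (deriv_coef P) n)); trivial.
  2: now apply geometric_lin.
  rewrite cpower_lin, !cpower_shift by trivial. unfold clf_weight.
  replace (RtoC (-24)) with (- (24))%C by (rewrite <- RtoC_opp; reflexivity). ring.
Qed.

Lemma CLF_deriv (P : nat -> R) (z : C) : is_CLF P -> Cmod z < 1/256 ->
  Cderiv (cpower P) z (cpower (deriv_coef P) z).
Proof. intros HP Hz. apply cpower_deriv; trivial; [now apply CLF_geometric | now apply CLF_deriv_geometric]. Qed.

Lemma flux_deriv (P : nat -> R) (z : C) : is_CLF P -> Cmod z < 1/256 ->
  Cderiv (cpower (flux_coef P)) z (8 * (1 - 16 * z) * cpower P z)%C.
Proof.
  intros HP Hz. assert (G := CLF_geometric P HP). assert (Hz' : Cmod z <= 1/256) by lra.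
  assert (F : geometric (fun n => 8 * P n + (-128) * shift P n)).
  { apply geometric_lin; [|now apply geometric_shift].
    (* The multiple [8 * P n] is split to fit the form [a n + c * b n] of [geometric_lin]. *)
    apply geometric_ext with (fun n => P n + 7 * P n); [intros n; ring | now apply geometric_lin]. }
  replace (8 * (1 - 16 * z) * cpower P z)%C with (cpower (deriv_coef (flux_coef P)) z).
  - apply cpower_deriv; trivial; [now apply flux_geometric|].
    apply geometric_ext with (2 := F). intros n. now apply flux_coef_deriv.
  - rewrite (cpower_ext _ (deriv_coef (flux_coef P)) z F); trivial; [|intros n; now apply flux_coef_deriv].
    rewrite (cpower_ext (fun n => (P n + 7 * P n) + (-128) * shift P n)); trivial.
    + rewrite (cpower_lin (fun n => P n + 7 * P n)), cpower_lin, cpower_shift by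
        (trivial; (now apply geometric_lin) || now apply geometric_shift).
      replace (RtoC (-128)) with (- (128))%C by (rewrite <- RtoC_opp; reflexivity). ring.
    + apply geometric_lin; [now apply geometric_lin | now apply geometric_shift].
    + intros n. ring.
Qed.

(** * Complex derivatives *)

Lemma vanishes_ext (k : nat) (f g : C -> C) : (forall h, f h = g h) -> vanishes k f -> vanishes k g.
Proof.
  intros E [K [r [HK [Hr H]]]]. exists K, r. split; [|split]; trivial. intros h Hh. rewrite <- E. now apply H.
Qed.

Lemma vanishes_plus (k : nat) (f g : C -> C) :
  vanishes k f -> vanishes k g -> vanishes k (fun h => f h + g h)%C.
Proof.
  intros [K [r [HK [Hr H]]]] [L [s [HL [Hs G]]]].
  exists (K + L), (Rmin r s). split; [lra|split].
  - split; [apply Rmin_pos; lra | apply Rle_trans with (1 := Rmin_l r s); lra].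
  - intros h Hh. eapply Rle_trans; [apply Cmod_triangle|]. rewrite Rmult_plus_distr_r.
    apply Rplus_le_compat; [apply H | apply G]; apply Rle_trans with (1 := Hh); [apply Rmin_l | apply Rmin_r].
Qed.

Lemma vanishes_mult (j k : nat) (f g : C -> C) :
  vanishes j f -> vanishes k g -> vanishes (j + k) (fun h => f h * g h)%C.
Proof.
  intros [K [r [HK [Hr H]]]] [L [s [HL [Hs G]]]].
  exists (K * L), (Rmin r s). split; [now apply Rmult_le_pos|split].
  - split; [apply Rmin_pos; lra | apply Rle_trans with (1 := Rmin_l r s); lra].
  - intros h Hh. rewrite Cmod_mult, pow_add.
    replace (K * L * (Cmod h ^ j * Cmod h ^ k)) with ((K * Cmod h ^ j) * (L * Cmod h ^ k)) by ring.
    apply Rmult_le_compat; try apply Cmod_ge_0; [apply H | apply G];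
      apply Rle_trans with (1 := Hh); [apply Rmin_l | apply Rmin_r].
Qed.

Lemma vanishes_le (j k : nat) (f : C -> C) : (j <= k)%nat -> vanishes k f -> vanishes j f.
Proof.
  intros Hjk [K [r [HK [Hr H]]]]. exists K, r. split; [|split]; trivial. intros h Hh.
  apply Rle_trans with (1 := H h Hh). apply Rmult_le_compat_l; trivial.
  replace k with (j + (k - j))%nat by lia. rewrite pow_add.
  assert (H0 := Cmod_ge_0 h). assert (0 <= Cmod h ^ j) by now apply pow_le.
  assert (Cmod h ^ (k - j) <= 1) by (rewrite <- (pow1 (k - j)); apply pow_incr; lra).
  rewrite <- (Rmult_1_r (Cmod h ^ j)) at 2. now apply Rmult_le_compat_l.
Qed.

Lemma vanishes_const (c : C) : vanishes 0 (fun _ => c).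
Proof.
  exists (Cmod c), 1. split; [apply Cmod_ge_0|split; [lra|]]. intros h _. simpl. lra.
Qed.

Lemma vanishes_id : vanishes 1 (fun h => h).
Proof. exists 1, 1. split; [lra|split; [lra|]]. intros h _. simpl. lra. Qed.

Lemma vanishes_comp (k : nat) (f g : C -> C) :
  vanishes k f -> vanishes 1 g -> vanishes k (fun h => f (g h)).
Proof.
  intros [K [r [HK [Hr H]]]] [L [s [HL [Hs G]]]].
  assert (P : 0 < r / (L + 1)) by (apply Rdiv_lt_0_compat; lra).
  exists (K * L ^ k), (Rmin (r / (L + 1)) s). split; [|split].
  - apply Rmult_le_pos; trivial. now apply pow_le.
  - split; [apply Rmin_pos; lra | apply Rle_trans with (1 := Rmin_r _ s); lra].
  - intros h Hh. assert (H0 := Cmod_ge_0 h).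
    assert (A := G h (Rle_trans _ _ _ Hh (Rmin_r _ _))). simpl in A. rewrite Rmult_1_r in A.
    assert (B := Rle_trans _ _ _ Hh (Rmin_l _ _)).
    assert (D : Cmod (g h) <= r).
    { apply Rle_trans with (1 := A). apply Rle_trans with ((L + 1) * (r / (L + 1))); [|right; field; lra].
      apply Rmult_le_compat; lra. }
    apply Rle_trans with (1 := H _ D). rewrite Rmult_assoc, <- Rpow_mult_distr.
    apply Rmult_le_compat_l; trivial. apply pow_incr. split; trivial. apply Cmod_ge_0.
Qed.

Lemma Cderiv_lipschitz (f : C -> C) (z d : C) : Cderiv f z d -> vanishes 1 (fun h => f (z + h) - f z)%C.
Proof.
  intros H. apply vanishes_ext with (fun h => (f (z + h) - f z - d * h) + d * h)%C; [intros h; ring|].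
  apply vanishes_plus; [now apply vanishes_le with 2%nat; [lia|]|].
  apply (vanishes_mult 0 1); [apply vanishes_const | apply vanishes_id].
Qed.

Lemma Cderiv_eq (f : C -> C) (z d d' : C) : Cderiv f z d -> d = d' -> Cderiv f z d'.
Proof. now intros H <-. Qed.

Lemma Cderiv_const (c z : C) : Cderiv (fun _ => c) z 0.
Proof.
  exists 0, 1. split; [lra|split; [lra|]]. intros h _.
  replace (c - c - 0 * h)%C with (RtoC 0) by ring. rewrite Cmod_0. lra.
Qed.

Lemma Cderiv_id (z : C) : Cderiv (fun y => y) z 1.
Proof.
  exists 0, 1. split; [lra|split; [lra|]]. intros h _.
  replace (z + h - z - 1 * h)%C with (RtoC 0) by ring. rewrite Cmod_0. lra.
Qed.

Lemma Cderiv_plus (f g : C -> C) (z d e : C) :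
  Cderiv f z d -> Cderiv g z e -> Cderiv (fun y => f y + g y)%C z (d + e)%C.
Proof.
  intros Hf Hg. eapply vanishes_ext; [|exact (vanishes_plus _ _ _ Hf Hg)]. intros h; simpl; ring.
Qed.

Lemma Cderiv_mult (f g : C -> C) (z d e : C) :
  Cderiv f z d -> Cderiv g z e -> Cderiv (fun y => f y * g y)%C z (d * g z + f z * e)%C.
Proof.
  intros Hf Hg.
  assert (Lg := Cderiv_lipschitz _ _ _ Hg).
  assert (Bg : vanishes 0 (fun h => g (z + h)%C)).
  { apply vanishes_ext with (fun h => (g (z + h) - g z) + g z)%C; [intros h; ring|].
    apply vanishes_plus; [now apply vanishes_le with 1%nat; [lia|] | apply vanishes_const]. }
  apply vanishes_ext with (fun h => (f (z + h) - f z - d * h) * g (z + h) +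
    (f z * (g (z + h) - g z - e * h) + d * (h * (g (z + h) - g z))))%C; [intros h; ring|].
  apply vanishes_plus; [|apply vanishes_plus].
  - exact (vanishes_mult 2 0 _ _ Hf Bg).
  - exact (vanishes_mult 0 2 _ _ (vanishes_const _) Hg).
  - exact (vanishes_mult 0 2 _ _ (vanishes_const _) (vanishes_mult 1 1 _ _ vanishes_id Lg)).
Qed.

Lemma Cderiv_minus (f g : C -> C) (z d e : C) :
  Cderiv f z d -> Cderiv g z e -> Cderiv (fun y => f y - g y)%C z (d - e)%C.
Proof.
  intros Hf Hg. assert (Hm := vanishes_mult 0 2 _ _ (vanishes_const (- (1))%C) Hg).
  eapply vanishes_ext; [|exact (vanishes_plus _ _ _ Hf Hm)]. intros h; simpl; ring.
Qed.

Lemma Cderiv_comp (f g : C -> C) (z d e : C) :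
  Cderiv f (g z) d -> Cderiv g z e -> Cderiv (fun y => f (g y)) z (d * e)%C.
Proof.
  intros Hf Hg.
  assert (Hc := vanishes_comp _ _ _ Hf (Cderiv_lipschitz _ _ _ Hg)).
  assert (Hm := vanishes_mult 0 2 _ _ (vanishes_const d) Hg).
  eapply vanishes_ext; [|exact (vanishes_plus _ _ _ Hc Hm)]. intros h; simpl.
  replace (g z + (g (z + h) - g z))%C with (g (z + h)%C) by ring. ring.
Qed.

Lemma Cderiv_Cinv (w : C) : w <> 0 -> Cderiv Cinv w (- / (w * w))%C.
Proof.
  intros Hw. assert (P : 0 < Cmod w) by now apply Cmod_gt_0.
  exists (2 * / Cmod w ^ 3), (Rmin 1 (Cmod w / 2)). split; [|split].
  - assert (0 < / Cmod w ^ 3) by (apply Rinv_0_lt_compat; now apply pow_lt). lra.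
  - split; [apply Rmin_pos; lra | apply Rmin_l].
  - intros h Hh. assert (B := Rle_trans _ _ _ Hh (Rmin_r _ _)).
    assert (T : Cmod w / 2 <= Cmod (w + h)).
    { assert (T := Cmod_triangle (w + h) (- h)). rewrite Cmod_opp in T.
      replace (w + h + - h)%C with w in T by ring. lra. }
    assert (N : (w + h)%C <> 0) by (apply Cmod_gt_0; lra).
    replace (/ (w + h) - / w - - / (w * w) * h)%C with (h ^ 2 * / (w ^ 2 * (w + h)))%C
      by (field; now split).
    rewrite Cmod_mult, Cmod_inv, Cmod_mult, !Cmod_pow by (apply Cmult_neq_0; trivial; now apply Cpow_nz).
    rewrite (Rmult_comm (2 * _)). apply Rmult_le_compat_l; [apply pow_le, Cmod_ge_0|].
    replace (2 * / Cmod w ^ 3) with (/ (Cmod w ^ 2 * (Cmod w / 2))) by (field; lra).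
    assert (0 < Cmod w ^ 2) by now apply pow_lt.
    apply Rinv_le_contravar; [apply Rmult_lt_0_compat; lra|]. apply Rmult_le_compat_l; lra.
Qed.

Lemma Cderiv_inv (f : C -> C) (z d : C) : f z <> 0 -> Cderiv f z d ->
  Cderiv (fun y => / f y)%C z (- / (f z * f z) * d)%C.
Proof. intros H Hf. apply (Cderiv_comp Cinv f); trivial. now apply Cderiv_Cinv. Qed.

(** Restricting to a ray and to the real part makes the real mean value theorem applicable. *)
Lemma Cderiv_ray (f : C -> C) (z d : C) (x : R) : Cderiv f (x * z)%C d ->
  is_derive (fun t : R => Re (f (t * z)%C)) x (Re (d * z)%C).
Proof.
  intros [K [r [HK [Hr H]]]]. apply is_derive_Reals. intros eps Heps.
  assert (H0 := Cmod_ge_0 z).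
  set (B := K * Cmod z ^ 2 + 1). assert (HB : 0 < B).
  { unfold B. assert (0 <= K * Cmod z ^ 2) by (apply Rmult_le_pos; trivial; now apply pow_le). lra. }
  assert (P1 : 0 < r / (Cmod z + 1)) by (apply Rdiv_lt_0_compat; lra).
  assert (P2 : 0 < eps / B) by now apply Rdiv_lt_0_compat.
  exists (mkposreal _ (Rmin_pos _ _ P1 P2)). intros h Hh Hhd. simpl in Hhd.
  assert (A1 := Rlt_le_trans _ _ _ Hhd (Rmin_l _ _)). assert (A2 := Rlt_le_trans _ _ _ Hhd (Rmin_r _ _)).
  assert (Hp : 0 < Rabs h) by now apply Rabs_pos_lt.
  assert (S : Cmod (h * z) <= r).
  { rewrite Cmod_mult, Cmod_R. apply Rle_trans with (r / (Cmod z + 1) * (Cmod z + 1)); [|right; field; lra].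
    apply Rmult_le_compat; lra. }
  specialize (H _ S). rewrite Cmod_mult, Cmod_R in H.
  replace ((Re (f (RtoC (x + h)%R * z)%C) - Re (f (x * z)%C)) / h - Re (d * z)%C) with
    (Re (f (x * z + h * z) - f (x * z) - d * (h * z))%C / h).
  2: { replace (RtoC (x + h)%R * z)%C with (x * z + h * z)%C by (rewrite RtoC_plus; ring).
       replace (d * (h * z))%C with (h * (d * z))%C by ring.
       set (u := f (x * z + h * z)%C). set (v := f (x * z)%C). set (w := (d * z)%C).
       unfold Re; simpl. field. trivial. }
  rewrite Rabs_div by trivial.
  apply Rle_lt_trans with (K * Cmod z ^ 2 * Rabs h).
  - apply Rle_trans with (K * (Rabs h * Cmod z) ^ 2 / Rabs h).
    + apply Rmult_le_compat_r; [left; now apply Rinv_0_lt_compat|].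
      apply Rle_trans with (2 := H). apply re_le_Cmod.
    + right. field. lra.
  - apply Rle_lt_trans with (B * Rabs h).
    + apply Rmult_le_compat_r; [lra|]. unfold B. lra.
    + apply Rlt_le_trans with (B * (eps / B)); [|right; field; lra]. now apply Rmult_lt_compat_l.
Qed.

(** The value of the derivative at 0 is left open, because in the quotient argument below a weight
    vanishing at 0 has to be cancelled. Differentiability there supplies continuity at the end of
    the ray. *)
Lemma Re_Cderiv_0_const (f : C -> C) (d : C) (rho : R) :
  (forall z : C, z <> 0 -> Cmod z < rho -> Cderiv f z 0) -> Cderiv f 0 d ->
  forall z : C, Cmod z < rho -> Re (f z) = Re (f 0).
Proof.
  intros H H0 z Hz. destruct (Ceq_dec z 0) as [->|Nz]; trivial.
  assert (Hin : forall x, 0 < x <= 1 -> Cderiv f (x * z)%C 0).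
  { intros x Hx. apply H.
    - apply Cmult_neq_0; trivial. intros E. apply (f_equal Re) in E. simpl in E. lra.
    - rewrite Cmod_mult, Cmod_R, Rabs_pos_eq by lra. assert (P := Cmod_ge_0 z). nra. }
  destruct (MVT_gen (fun t : R => Re (f (t * z)%C)) 0 1 (fun _ => 0)) as [c [_ Hc]].
  - rewrite Rmin_left, Rmax_right by lra. intros x Hx.
    replace 0 with (Re (0 * z)%C) by (simpl; ring). apply Cderiv_ray, Hin. lra.
  - rewrite Rmin_left, Rmax_right by lra. intros x Hx. apply continuity_pt_filterlim.
    apply (ex_derive_continuous (K := R_AbsRing) (V := R_NormedModule) (fun t : R => Re (f (t * z)%C)) x).
    destruct (Rle_lt_or_eq_dec 0 x (proj1 Hx)) as [L|<-].
    + eexists. apply Cderiv_ray, Hin. lra.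
    + exists (Re (d * z)%C). apply Cderiv_ray. replace (0 * z)%C with (RtoC 0) by ring. exact H0.
  - replace (1 * z)%C with z in Hc by ring. replace (0 * z)%C with (RtoC 0) in Hc by ring. lra.
Qed.

Lemma Cderiv_0_const (f : C -> C) (d : C) (rho : R) :
  (forall z : C, z <> 0 -> Cmod z < rho -> Cderiv f z 0) -> Cderiv f 0 d ->
  forall z : C, Cmod z < rho -> f z = f 0.
Proof.
  intros H H0 z Hz.
  assert (A := Re_Cderiv_0_const f d rho H H0 z Hz).
  (* Multiplication by [- Ci] turns the imaginary part into the real part. *)
  assert (B : Re (- Ci * f z)%C = Re (- Ci * f 0)%C).
  { apply (Re_Cderiv_0_const (fun y => - Ci * f y)%C (0 * f 0 + - Ci * d)%C rho); trivial.
    - intros y Hy Hyr. eapply Cderiv_eq; [apply Cderiv_mult; [apply Cderiv_const | now apply H]|]. ring.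
    - apply (Cderiv_mult (fun _ => - Ci)%C); [apply Cderiv_const | trivial]. }
  apply injective_projections; [exact A|]. simpl in B. unfold Im, Re in B. lra.
Qed.

(** * The quadratic transformation *)

(** With [s = (1 - y) / (1 + y)], [lan_a y = (1 - s^2) / 16] and
    [lan_b y = (1 - 2 s / (1 + s^2)) / 16] are the parameters before and after one step of the
    arithmetic-geometric mean started at [(1, s^2)], and [lan_m y = (1 + s^2) / 2]. *)
Definition lan_a (y : C) : C := (y * / (4 * ((1 + y) * (1 + y))))%C.
Definition lan_b (y : C) : C := (y * y * / (8 * (1 + y * y)))%C.
Definition lan_m (y : C) : C := ((1 + y * y) * / ((1 + y) * (1 + y)))%C.
(** With the weight [w = y (1 - y^2) / (2 (1 + y^2))], [lan_u] is [w * lan_m'] and [lan_v] is [w *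
    lan_m * lan_a' / clf_weight (lan_a y)]. The form [0 - ...] suits [cderiv], which has a rule for
    differences but not for opposites. *)
Definition lan_u (y : C) : C :=
  ((0 - y * ((1 - y) * (1 - y))) * / ((1 + y * y) * ((1 + y) * (1 + y))))%C.
Definition lan_v (y : C) : C := ((1 + y) * (1 + y) * / (2 * (1 + y * y)))%C.

Ltac cderiv :=
  repeat first [ apply Cderiv_const | apply Cderiv_id | apply Cderiv_minus | apply Cderiv_plus
               | apply Cderiv_mult | apply Cderiv_inv ].

Lemma one_plus_neq_0 (y : C) : Cmod y <= 1/100 -> (1 + y)%C <> 0.
Proof.
  intros H. apply near_1_neq_0. replace (1 + y - 1)%C with y by ring. lra.
Qed.

Lemma one_minus_neq_0 (y : C) : Cmod y <= 1/100 -> (1 - y)%C <> 0.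
Proof.
  intros H. replace (1 - y)%C with (1 + - y)%C by ring. apply one_plus_neq_0. now rewrite Cmod_opp.
Qed.

Lemma one_plus_sq_neq_0 (y : C) : Cmod y <= 1/100 -> (1 + y * y)%C <> 0.
Proof.
  intros H. apply one_plus_neq_0. rewrite Cmod_mult. assert (P := Cmod_ge_0 y). nra.
Qed.

Lemma RtoC_neq_0 (x : R) : x <> 0 -> RtoC x <> 0.
Proof. intros H E. apply H. now apply (f_equal Re) in E. Qed.

Ltac nz := repeat split; repeat first [assumption | apply RtoC_neq_0; lra | apply Cmult_neq_0].

Lemma lan_a_deriv (y : C) : Cmod y <= 1/100 ->
  Cderiv lan_a y ((1 - y) * / (4 * ((1 + y) * (1 + y) * (1 + y))))%C.
Proof.
  intros H. assert (N := one_plus_neq_0 y H). unfold lan_a.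
  eapply Cderiv_eq; [cderiv; nz | cbv beta; field; nz].
Qed.

Lemma lan_b_deriv (y : C) : Cmod y <= 1/100 ->
  Cderiv lan_b y (y * / (4 * ((1 + y * y) * (1 + y * y))))%C.
Proof.
  intros H. assert (N := one_plus_sq_neq_0 y H). unfold lan_b.
  eapply Cderiv_eq; [cderiv; nz | cbv beta; field; nz].
Qed.

Lemma lan_m_deriv (y : C) : Cmod y <= 1/100 ->
  Cderiv lan_m y (2 * (y - 1) * / ((1 + y) * (1 + y) * (1 + y)))%C.
Proof.
  intros H. assert (N := one_plus_neq_0 y H). unfold lan_m.
  eapply Cderiv_eq; [cderiv; nz | cbv beta; field; nz].
Qed.

Lemma lan_v_deriv (y : C) : Cmod y <= 1/100 ->
  Cderiv lan_v y ((1 - y * y) * / ((1 + y * y) * (1 + y * y)))%C.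
Proof.
  intros H. assert (N := one_plus_sq_neq_0 y H). unfold lan_v.
  eapply Cderiv_eq; [cderiv; nz | cbv beta; field; nz].
Qed.

(** The equation matches the coefficients of [G (lan_a y)] when [lan_flux] is differentiated; [d]
    enters only through it and stays existential. *)
Lemma lan_u_deriv (y : C) : Cmod y <= 1/100 -> exists d : C, Cderiv lan_u y d /\
  (d + lan_v y * (8 * (1 - 16 * lan_a y)) * ((1 - y) * / (4 * ((1 + y) * (1 + y) * (1 + y)))) =
   8 * (1 - 16 * lan_b y) * (y * / (4 * ((1 + y * y) * (1 + y * y)))) * lan_m y)%C.
Proof.
  intros H. assert (N := one_plus_neq_0 y H). assert (N2 := one_plus_sq_neq_0 y H).
  eexists. split.
  - unfold lan_u. cderiv. nz.
  - unfold lan_v, lan_a, lan_b, lan_m. cbv beta; field; nz.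
Qed.

(** As [lan_a y] is about [y / 4], the radius 1/100 brings it into the disk where [cpower] is
    controlled: [3/10 * 1/100 < 1/256]. *)
Lemma lan_a_small (y : C) : Cmod y <= 1/100 -> Cmod (lan_a y) < 1/256 /\ Cmod (lan_a y) <= Cmod y.
Proof.
  intros H. assert (N := one_plus_neq_0 y H). assert (P := Cmod_ge_0 y). unfold lan_a.
  rewrite Cmod_mult, Cmod_inv, !Cmod_mult, Cmod_R, Rabs_pos_eq by (lra || nz).
  assert (A : 99/100 <= Cmod (1 + y)).
  { assert (T := Cmod_triangle (1 + y) (- y)). rewrite Cmod_opp in T.
    replace (1 + y + - y)%C with (RtoC 1) in T by ring. rewrite Cmod_1 in T. lra. }
  assert (B : / (4 * (Cmod (1 + y) * Cmod (1 + y))) <= 3/10).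
  { replace (3/10) with (/ (10/3)) by field. apply Rinv_le_contravar; nra. }
  assert (0 < / (4 * (Cmod (1 + y) * Cmod (1 + y)))) by (apply Rinv_0_lt_compat; nra).
  split; nra.
Qed.

Lemma lan_b_small (y : C) : Cmod y <= 1/100 -> Cmod (lan_b y) < 1/256 /\ Cmod (lan_b y) <= Cmod y.
Proof.
  intros H. assert (N := one_plus_sq_neq_0 y H). assert (P := Cmod_ge_0 y). unfold lan_b.
  rewrite Cmod_mult, Cmod_inv, !Cmod_mult, Cmod_R, Rabs_pos_eq by (lra || nz).
  assert (Cmod y * Cmod y <= Cmod y * (1/100)) by (apply Rmult_le_compat_l; lra).
  assert (0 <= Cmod y * Cmod y) by now apply Rmult_le_pos.
  assert (A : 99/100 <= Cmod (1 + y * y)).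
  { assert (T := Cmod_triangle (1 + y * y) (- (y * y))). rewrite Cmod_opp, Cmod_mult in T.
    replace (1 + y * y + - (y * y))%C with (RtoC 1) in T by ring. rewrite Cmod_1 in T. lra. }
  assert (B : / (8 * Cmod (1 + y * y)) <= 1/4).
  { replace (1/4) with (/ 4) by field. apply Rinv_le_contravar; lra. }
  assert (0 < / (8 * Cmod (1 + y * y))) by (apply Rinv_0_lt_compat; lra).
  split; nra.
Qed.

Lemma cpower_0 (P : nat -> R) : geometric P -> cpower P 0 = RtoC (P 0%nat).
Proof.
  intros HP. apply cpower_eq; trivial; [rewrite Cmod_0; lra|].
  apply filterlim_ext with (fun _ : nat => RtoC (P 0%nat)); [|apply filterlim_const].
  intros n. induction n as [|n IH].
  - rewrite sum_O. simpl. ring.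
  - rewrite sum_Sn, <- IH. change (RtoC (P 0%nat) = (P 0%nat + P (S n) * (0 * 0 ^ n))%C). ring.
Qed.

Lemma CLF_near_1 (P : nat -> R) : is_CLF P -> vanishes 1 (fun z => cpower P z - 1)%C.
Proof.
  intros HP. assert (D : Cmod 0 < 1/256) by (rewrite Cmod_0; lra).
  assert (L := Cderiv_lipschitz _ _ _ (CLF_deriv P 0 HP D)).
  eapply vanishes_ext; [|exact L]. intros h. simpl.
  rewrite (cpower_0 P) by now apply CLF_geometric.
  rewrite (proj1 HP). replace (0 + h)%C with h by ring. reflexivity.
Qed.

(** Equals [y (1 - y^2) / (2 (1 + y^2))] times the derivative of [lan_m y * G (lan_a y)]. *)
Definition lan_flux (P : nat -> R) (y : C) : C :=
  (lan_u y * cpower P (lan_a y) + lan_v y * cpower (flux_coef P) (lan_a y))%C.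

(** For [F = lan_m * G(lan_a)], [H = G(lan_b)] and [w] as above this is [w * (F * H' - F' * H)],
    written with fluxes so that no second derivative of [G] appears. *)
Definition lan_wronskian (P : nat -> R) (y : C) : C :=
  (lan_m y * cpower P (lan_a y) * cpower (flux_coef P) (lan_b y) -
   lan_flux P y * cpower P (lan_b y))%C.

(** In other words [F] solves [(w F')' = c F] with [c = 8 (1 - 16 lan_b) lan_b'], the equation that
    [G(lan_b)] satisfies by the chain rule. *)
Lemma lan_flux_deriv (P : nat -> R) (y : C) : is_CLF P -> Cmod y <= 1/100 ->
  Cderiv (lan_flux P) y
    (8 * (1 - 16 * lan_b y) * (y * / (4 * ((1 + y * y) * (1 + y * y)))) * (lan_m y * cpower P (lan_a y)))%C.
Proof.
  intros HP H. assert (Ha := proj1 (lan_a_small y H)).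
  assert (N := one_plus_neq_0 y H). assert (N2 := one_plus_sq_neq_0 y H).
  destruct (lan_u_deriv y H) as [d [Hu Hd]].
  assert (Da := lan_a_deriv y H).
  eapply Cderiv_eq.
  - unfold lan_flux. apply Cderiv_plus; apply Cderiv_mult.
    + exact Hu.
    + apply (Cderiv_comp (cpower P) lan_a); [now apply CLF_deriv | exact Da].
    + now apply lan_v_deriv.
    + apply (Cderiv_comp (cpower (flux_coef P)) lan_a); [now apply flux_deriv | exact Da].
  - cbv beta. rewrite flux_eq by (trivial; lra).
    set (g := cpower P (lan_a y)). set (g' := cpower (deriv_coef P) (lan_a y)).
    (* Sorted by [G] and [G'] at [lan_a y]: the first coefficient is known from [lan_u_deriv], the
       second is identically 0. *)
    transitivity ((d + lan_v y * (8 * (1 - 16 * lan_a y)) * ((1 - y) * / (4 * ((1 + y) * (1 + y) * (1 + y))))) * g +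
      (lan_u y * ((1 - y) * / (4 * ((1 + y) * (1 + y) * (1 + y)))) +
       (1 - y * y) * / ((1 + y * y) * (1 + y * y)) * clf_weight (lan_a y)) * g')%C; [ring|].
    rewrite Hd.
    replace (lan_u y * ((1 - y) * / (4 * ((1 + y) * (1 + y) * (1 + y)))) +
       (1 - y * y) * / ((1 + y * y) * (1 + y * y)) * clf_weight (lan_a y))%C with (RtoC 0); [ring|].
    unfold lan_u, clf_weight, lan_a. field; nz.
Qed.

Lemma lan_left_deriv (P : nat -> R) (y : C) : is_CLF P -> Cmod y <= 1/100 -> exists d : C,
  Cderiv (fun y => lan_m y * cpower P (lan_a y))%C y d /\
  (y * (1 - y * y) * / (2 * (1 + y * y)) * d = lan_flux P y)%C.
Proof.
  intros HP H. assert (Ha := proj1 (lan_a_small y H)).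
  assert (N := one_plus_neq_0 y H). assert (N2 := one_plus_sq_neq_0 y H).
  eexists. split.
  - apply Cderiv_mult; [now apply lan_m_deriv|].
    apply (Cderiv_comp (cpower P) lan_a); [now apply CLF_deriv | now apply lan_a_deriv].
  - cbv beta. unfold lan_flux. rewrite flux_eq by (trivial; lra).
    set (g := cpower P (lan_a y)). set (g' := cpower (deriv_coef P) (lan_a y)).
    unfold lan_m, lan_u, lan_v, clf_weight, lan_a. field; nz.
Qed.

(** This determines [w]: multiplied by it, the derivative of [G(lan_b)] becomes the flux of [G] at
    [lan_b y]. *)
Lemma lan_weight (y : C) : Cmod y <= 1/100 ->
  (y * (1 - y * y) * / (2 * (1 + y * y)) * (y * / (4 * ((1 + y * y) * (1 + y * y)))) = clf_weight (lan_b y))%C.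
Proof.
  intros H. assert (N2 := one_plus_sq_neq_0 y H). unfold clf_weight, lan_b. field; nz.
Qed.

(** Both solutions obey one self-adjoint equation, so the Wronskian is constant; at [y = 0] both
    fluxes vanish with their weights. *)
Lemma lan_wronskian_0 (P : nat -> R) (y : C) : is_CLF P -> Cmod y < 1/100 -> lan_wronskian P y = 0.
Proof.
  intros HP Hy.
  assert (D : forall y, Cmod y < 1/100 -> Cderiv (lan_wronskian P) y 0).
  { clear y Hy. intros y Hy. assert (H : Cmod y <= 1/100) by lra.
    assert (Hb := proj1 (lan_b_small y H)).
    destruct (lan_left_deriv P y HP H) as [d [Dl Hd]].
    eapply Cderiv_eq.
    - unfold lan_wronskian. apply Cderiv_minus; apply Cderiv_mult.
      + exact Dl.
      + apply (Cderiv_comp (cpower (flux_coef P)) lan_b); [now apply flux_deriv | now apply lan_b_deriv].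
      + now apply lan_flux_deriv.
      + apply (Cderiv_comp (cpower P) lan_b); [now apply CLF_deriv | now apply lan_b_deriv].
    - cbv beta. rewrite <- Hd, flux_eq, <- lan_weight by (trivial; lra). ring. }
  assert (Z : Cmod 0 < 1/100) by (rewrite Cmod_0; lra).
  rewrite (Cderiv_0_const (lan_wronskian P) 0 (1/100)); trivial; [|intros z _ Hz; now apply D|now apply D].
  assert (Za : lan_a 0 = 0) by (unfold lan_a; ring).
  assert (Zb : lan_b 0 = 0) by (unfold lan_b; ring).
  assert (Zu : lan_u 0 = 0) by (unfold lan_u; ring).
  unfold lan_wronskian, lan_flux. rewrite Za, Zb, Zu, flux_eq by (trivial; rewrite Cmod_0; lra).
  unfold clf_weight. ring.
Qed.

Lemma quadratic_transformation (P : nat -> R) : is_CLF P -> exists r : R, 0 < r <= 1/100 /\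
  forall y : C, Cmod y < r -> (lan_m y * cpower P (lan_a y) = cpower P (lan_b y))%C.
Proof.
  intros HP. destruct (CLF_near_1 P HP) as [K [s [HK [Hs Hn]]]].
  assert (P1 : 0 < / (2 * (K + 1))) by (apply Rinv_0_lt_compat; lra).
  (* The last bound keeps [G (lan_b y)] within [K / (2 (K + 1)) < 1] of 1, hence away from 0, so
     that one may divide by it. *)
  set (r := Rmin (1/100) (Rmin s (/ (2 * (K + 1))))).
  assert (Hr1 : r <= 1/100) by apply Rmin_l.
  assert (Hr2 : r <= s) by (eapply Rle_trans; [apply Rmin_r | apply Rmin_l]).
  assert (Hr3 : r <= / (2 * (K + 1))) by (eapply Rle_trans; [apply Rmin_r | apply Rmin_r]).
  assert (Hr0 : 0 < r) by (repeat apply Rmin_pos; lra).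
  exists r. split; [lra|].
  assert (NG : forall y, Cmod y < r -> cpower P (lan_b y) <> 0).
  { intros y Hy. apply near_1_neq_0.
    assert (B : Cmod (lan_b y) <= Cmod y) by (apply lan_b_small; lra).
    assert (X := Hn (lan_b y)). simpl in X. rewrite Rmult_1_r in X.
    assert (X' : Cmod (lan_b y) <= s) by lra. specialize (X X').
    assert (Y : K * Cmod (lan_b y) <= K * / (2 * (K + 1))) by (apply Rmult_le_compat_l; lra).
    assert (K * / (2 * (K + 1)) < 1).
    { apply Rmult_lt_reg_r with (2 * (K + 1)); [lra|]. rewrite Rmult_assoc, Rinv_l; lra. }
    lra. }
  set (N := fun y => (lan_m y * cpower P (lan_a y) * / cpower P (lan_b y))%C).
  (* The derivative of [N] is minus the Wronskian over [w * G(lan_b)^2]; as [w] vanishes at 0, it is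
     evaluated only for [y <> 0]. *)
  assert (D : forall y, Cmod y < r -> exists d, Cderiv N y d /\ (y <> 0 -> d = 0)).
  { intros y Hy. assert (H : Cmod y <= 1/100) by lra.
    assert (Hb := proj1 (lan_b_small y H)). assert (W := lan_wronskian_0 P y HP ltac:(lra)).
    destruct (lan_left_deriv P y HP H) as [d [Dl Hd]].
    eexists. split.
    - unfold N. apply Cderiv_mult; [exact Dl|]. apply Cderiv_inv; [now apply NG|].
      apply (Cderiv_comp (cpower P) lan_b); [now apply CLF_deriv | now apply lan_b_deriv].
    - intros Hy0. cbv beta. assert (NGy := NG y Hy).
      unfold lan_wronskian in W. rewrite <- Hd, flux_eq, <- lan_weight in W by (trivial; lra).
      assert (N2 := one_plus_sq_neq_0 y H). assert (N3 := one_minus_neq_0 (y * y)).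
      assert (N4 : (1 - y * y)%C <> 0).
      { apply N3. rewrite Cmod_mult. assert (Pc := Cmod_ge_0 y). nra. }
      set (g := cpower P (lan_b y)) in *. set (g' := cpower (deriv_coef P) (lan_b y)) in *.
      set (f := (lan_m y * cpower P (lan_a y))%C) in *.
      set (b' := (y * / (4 * ((1 + y * y) * (1 + y * y))))%C) in *.
      set (w := (y * (1 - y * y) * / (2 * (1 + y * y)))%C) in *.
      assert (Nw : w <> 0).
      { unfold w. repeat apply Cmult_neq_0; trivial. intros Z.
        assert (E1 : (/ (2 * (1 + y * y)) * (2 * (1 + y * y)) = 1)%C) by (field; nz).
        rewrite Z in E1. apply C1_nz. rewrite <- E1. ring. }
      transitivity (- (f * (w * b' * g') - w * d * g) / (w * (g * g)))%C; [field; nz|].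
      rewrite W. field; nz. }
  intros y Hy.
  assert (Z : Cmod 0 < r) by (rewrite Cmod_0; lra).
  destruct (D (RtoC 0) Z) as [d0 [D0 _]].
  assert (F : N y = N 0).
  { apply (Cderiv_0_const N d0 r); trivial. intros z Hz Hzr. destruct (D z Hzr) as [d [Dz Ez]].
    now rewrite <- (Ez Hz). }
  assert (NGy := NG y Hy). assert (NG0 := NG _ Z).
  assert (Za : lan_a 0 = 0) by (unfold lan_a; ring).
  assert (Zb : lan_b 0 = 0) by (unfold lan_b; ring).
  assert (F0 : N 0 = 1).
  { unfold N. rewrite Zb in NG0 |- *. rewrite Za. unfold lan_m. field. nz. }
  replace (lan_m y * cpower P (lan_a y))%C with (N y * cpower P (lan_b y))%C by (unfold N; field; trivial).
  rewrite F, F0. ring.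
Qed.

(** * Modular parametrisation *)

(** [t] as a function of [q]. *)
Definition hauptmodul (q : C) : C :=
  (RtoC (1/2) * q * (E q ^ 4 * E (q ^ 4) ^ 2 * E (q ^ 8) ^ 4) / E (q ^ 2) ^ 10)%C.

(** Collecting Euler products gives [t = (q / 2) * psi(q^4)^2 / theta(q)^2], and
    [theta_diff_squares] rewrites the numerator. *)
Lemma hauptmodul_theta :
  small (fun q => hauptmodul q = ((theta q ^ 2 - theta (- q) ^ 2) / (16 * theta q ^ 2))%C).
Proof.
  apply small_imp with (2 := theta_diff_squares). intros q Hq H D. rewrite D.
  assert (N1 := eta_prod_neq_0 q H). assert (N2 := eta_prod_neq_0 _ (proj1 (Cmod_pow_le q 1 H))).
  assert (N4 := eta_prod_neq_0 _ (proj1 (Cmod_pow_le q 3 H))).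
  unfold hauptmodul, psi. replace ((q ^ 4) ^ 2)%C with (q ^ 8)%C by ring.
  replace (theta q) with (E (q ^ 2) ^ 5 / (E q ^ 2 * E (q ^ 4) ^ 2))%C.
  - replace (RtoC (1/2)) with (/ 2)%C by (rewrite RtoC_div by lra; field).
    field. nz.
  - rewrite <- theta_eta by trivial. field. now split.
Qed.

(** By [theta_bisection] this [y] equals [(theta q - theta (- q)) / (theta q + theta (- q))], so the
    ratio [s] behind the [lan] functions is [theta (- q) / theta q]. *)
Lemma landen_step : small (fun q => exists y : C, y = (theta q * / theta (q ^ 4) - 1)%C /\
  hauptmodul q = lan_a y /\ hauptmodul (q ^ 2) = lan_b y /\ (theta (q ^ 2) ^ 2 = lan_m y * theta q ^ 2)%C).
Proof.
  assert (P : 0 < 1/2) by lra.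
  assert (Nt := near_one_close _ _ P near_one_theta).
  apply small_imp with (2 := small_and _ _ (small_and _ _ hauptmodul_theta (small_pow 1 _ hauptmodul_theta))
    (small_and _ _ theta_sum_squares (small_and _ _ Nt (small_and _ _ (small_pow 1 _ Nt) (small_pow 3 _ Nt))))).
  intros q Hq H [[T1 T2] [S [C1 [C2 C4]]]].
  assert (M := theta_mul_opp q H). assert (B := theta_bisection q H).
  assert (N1 : theta q <> 0) by (apply near_1_neq_0; lra).
  assert (N2 : theta (q ^ 2) <> 0) by (apply near_1_neq_0; lra).
  assert (N4 : theta (q ^ 4) <> 0) by (apply near_1_neq_0; lra).
  eexists. split; [reflexivity|].
  rewrite T1, T2, <- M.
  set (p := theta q) in *. set (n := theta (- q)) in *. set (c := theta (q ^ 2)) in *.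
  set (d := theta (q ^ 4)) in *.
  assert (Ec : (c ^ 2 = (p ^ 2 + n ^ 2) / 2)%C) by (rewrite S; field).
  assert (Ed : d = ((p + n) / 2)%C) by (rewrite B; field).
  assert (Nd : (p + n)%C <> 0) by (rewrite B; nz).
  assert (Nc : (p ^ 2 + n ^ 2)%C <> 0) by (rewrite S; nz; now apply Cpow_nz).
  assert (Ns : (1 + (p * / d - 1) * (p * / d - 1))%C = (2 * (p ^ 2 + n ^ 2) / (p + n) ^ 2)%C).
  { rewrite Ed. field. nz. }
  assert (Np : (1 + (p * / d - 1))%C = (2 * p / (p + n))%C) by (rewrite Ed; field; nz).
  unfold lan_a, lan_b, lan_m. rewrite Ns, Np, Ec, Ed.
  repeat split; field; nz.
Qed.

Lemma CLF_theta (P : nat -> R) : is_CLF P ->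
  small (fun q => Cmod (hauptmodul q) <= 1/256 /\ (cpower P (hauptmodul q) = theta q ^ 2)%C).
Proof.
  intros HP.
  assert (Ny : bigO (fun q => theta q * / theta (q ^ 4) - 1)%C).
  { apply near_one_mult; [apply near_one_theta | apply near_one_inv].
    exact (bigO_pow 3 _ near_one_theta). }
  destruct (quadratic_transformation P HP) as [r [Hr Q]].
  assert (Hr2 : 0 < r / 2) by lra.
  assert (Cy : small (fun q => Cmod (theta q * / theta (q ^ 4) - 1)%C <= r / 2)).
  { apply near_one_close with (f := fun q => (theta q * / theta (q ^ 4))%C); trivial. }
  assert (Bt : bigO hauptmodul).
  { destruct Ny as [K [HK H]]. exists K. split; trivial.
    apply small_imp with (2 := small_and _ _ (small_and _ _ Cy H) landen_step).
    intros q _ _ [[A A'] [y [Ey [Ta _]]]]. rewrite Ta. rewrite <- Ey in A, A'.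
    apply Rle_trans with (2 := A'). apply lan_a_small. lra. }
  assert (Sm : forall d, 0 < d -> small (fun q => Cmod (hauptmodul q) <= d)).
  { intros d Hd.
    (* Adding 1 turns smallness into closeness to 1, the form handled by [near_one_close]. *)
    assert (N : near_one (fun q => hauptmodul q + 1)%C).
    { apply bigO_ext with (2 := Bt). apply small_imp with (2 := small_disk 1 Rlt_0_1). intros q _ _ _. ring. }
    apply small_imp with (2 := near_one_close _ d Hd N).
    intros q _ _ Hb. now replace (hauptmodul q + 1 - 1)%C with (hauptmodul q) in Hb by ring. }
  assert (N2 := near_one_pow 2 _ near_one_theta).
  set (g := fun q => (cpower P (hauptmodul q) - theta q ^ 2)%C).
  assert (G : small (fun q => g q = 0)).
  { apply squaring_contraction.
    - apply bigO_ext with (fun q => (cpower P (hauptmodul q) - 1) + (-1) * (theta q ^ 2 - 1))%C.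
      { apply small_imp with (2 := small_disk 1 Rlt_0_1). intros q _ _ _. unfold g. ring. }
      apply bigO_plus; [|now apply bigO_scal].
      destruct (CLF_near_1 P HP) as [L [s [HL [Hs Hn]]]].
      assert (Ss := Sm s (proj1 Hs)).
      destruct Bt as [K [HK H]]. exists (L * K). split; [now apply Rmult_le_pos|].
      apply small_imp with (2 := small_and _ _ Ss H). intros q _ _ [A B].
      apply Rle_trans with (1 := Hn _ A). simpl. rewrite Rmult_1_r, Rmult_assoc.
      now apply Rmult_le_compat_l.
    - assert (P1 : 0 < 1/2) by lra.
      assert (Nm : near_one (fun q => theta (q ^ 2) ^ 2 * / theta q ^ 2)%C).
      { apply near_one_mult; [apply near_one_pow; exact (bigO_pow 1 _ near_one_theta) | now apply near_one_inv]. }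
      apply small_imp with (2 := small_and _ _ (small_and _ _ landen_step Cy)
        (small_and _ _ (near_one_close _ _ P1 Nm) (near_one_close _ _ P1 N2))).
      intros q _ _ [[[y [Ey [Ta [Tb Tm]]]] Hy] [A B]].
      rewrite <- Ey in Hy.
      assert (Nt : (theta q ^ 2)%C <> 0) by (apply near_1_neq_0; lra).
      assert (Em : lan_m y = (theta (q ^ 2) ^ 2 * / theta q ^ 2)%C) by (rewrite Tm; field; intros Z; apply Nt; rewrite Z; ring).
      rewrite <- Em in A. apply Cmod_near_1 in A.
      (* Both terms of [g] acquire the same multiplier; its modulus is at least 1/2, which is the
         factor 2 required. *)
      assert (F : g (q ^ 2)%C = (lan_m y * g q)%C).
      { unfold g. rewrite Tb, Tm, <- Q, Ta by lra. ring. }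
      rewrite F, Cmod_mult. assert (H0 := Cmod_ge_0 (g q)). nra. }
  assert (P256 : 0 < 1/256) by lra.
  apply small_imp with (2 := small_and _ _ (Sm _ P256) G). unfold g. intros q _ _ [A B]. split; trivial.
  replace (cpower P (hauptmodul q)) with (cpower P (hauptmodul q) - theta q ^ 2 + theta q ^ 2)%C by ring.
  rewrite B. ring.
Qed.

(** * The complex exponential and the return from [q] to [tau] *)

Lemma Cexp_plus (a b : C) : Cexp (a + b)%C = (Cexp a * Cexp b)%C.
Proof.
  unfold Cexp. destruct a as [a1 a2], b as [b1 b2]. simpl. rewrite exp_plus, cos_plus, sin_plus.
  unfold Cmult. simpl. f_equal; ring.
Qed.

Lemma Cexp_mult_nat (n : nat) (a : C) : Cexp (INR n * a)%C = (Cexp a ^ n)%C.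
Proof.
  induction n as [|n IH].
  - unfold Cexp. simpl. rewrite !Rmult_0_l, Rminus_0_r, Rplus_0_l, exp_0, cos_0, sin_0.
    unfold RtoC. f_equal; ring.
  - rewrite S_INR, RtoC_plus, Cpow_S, <- IH, <- Cexp_plus. f_equal. ring.
Qed.

Lemma Cmod_Cexp (a : C) : Cmod (Cexp a) = exp (Re a).
Proof.
  assert (H : Cmod (Cexp a) ^ 2 = exp (Re a) ^ 2).
  { rewrite Cmod2_alt. unfold Cexp. simpl. assert (S := sin2_cos2 (Im a)). unfold Rsqr in S.
    transitivity (exp (Re a) ^ 2 * (sin (Im a) * sin (Im a) + cos (Im a) * cos (Im a))); [ring|].
    rewrite S. ring. }
  apply Rsqr_inj; [apply Cmod_ge_0 | left; apply exp_pos | unfold Rsqr; lra].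
Qed.

Lemma Cexp_neq_0 (a : C) : Cexp a <> 0.
Proof. apply Cmod_gt_0. rewrite Cmod_Cexp. apply exp_pos. Qed.

(** [q^(1/24)], the branch built into [eta]. *)
Definition qroot (tau : C) : C := Cexp (RtoC (2 * PI / 24) * (Ci * tau))%C.

Lemma qnome_root (tau : C) : qnome tau = (qroot tau ^ 24)%C.
Proof.
  unfold qroot. rewrite <- Cexp_mult_nat. unfold qnome. f_equal.
  assert (H : 2 * PI = INR 24 * (2 * PI / 24)) by (simpl; field).
  rewrite H at 1. rewrite RtoC_mult. ring.
Qed.

Lemma eta_multiple (k : nat) (tau : C) :
  eta (INR k * tau)%C = (qroot tau ^ k * E (qnome tau ^ k))%C.
Proof.
  unfold eta, qroot, qnome. rewrite <- !Cexp_mult_nat. f_equal; [f_equal; ring|].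
  f_equal. f_equal. ring.
Qed.

Lemma Cmod_qnome (tau : C) : Cmod (qnome tau) = exp (- (2 * PI * Im tau)).
Proof.
  unfold qnome. rewrite Cmod_Cexp. f_equal. destruct tau as [x y]. simpl. ring.
Qed.

(** The inequality [exp x >= 1 + x] gives a generous explicit threshold without logarithms. *)
Lemma Cmod_qnome_small (tau : C) (r : R) : 0 < r -> / r < Im tau -> Cmod (qnome tau) <= r.
Proof.
  intros Hr H. rewrite Cmod_qnome, exp_Ropp.
  assert (P : 0 < / r) by now apply Rinv_0_lt_compat.
  rewrite <- (Rinv_inv r). apply Rinv_le_contravar; trivial.
  assert (A := exp_ineq1_le (2 * PI * Im tau)). assert (B := PI2_1).
  assert (1 * Im tau <= 2 * PI * Im tau) by (apply Rmult_le_compat_r; lra). lra.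
Qed.

Lemma eta_quotients (tau : C) : Cmod (qnome tau) <= 1/4 ->
  tfun tau = hauptmodul (qnome tau) /\ ffun tau = (theta (qnome tau) ^ 2)%C.
Proof.
  intros H. set (q := qnome tau) in *. set (w := qroot tau).
  assert (N1 := eta_prod_neq_0 q H). assert (N2 := eta_prod_neq_0 _ (proj1 (Cmod_pow_le q 1 H))).
  assert (N4 := eta_prod_neq_0 _ (proj1 (Cmod_pow_le q 3 H))).
  assert (Nw : w <> 0) by apply Cexp_neq_0.
  assert (Ew : q = (w ^ 24)%C) by apply qnome_root.
  assert (I2 : INR 2 = 2) by (simpl; ring). assert (I4 : INR 4 = 4) by (simpl; ring).
  assert (I8 : INR 8 = 8) by (simpl; ring).
  assert (T1 := eta_multiple 1 tau). assert (T2 := eta_multiple 2 tau).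
  assert (T4 := eta_multiple 4 tau). assert (T8 := eta_multiple 8 tau).
  rewrite I2 in T2. rewrite I4 in T4. rewrite I8 in T8. simpl INR in T1.
  rewrite Cmult_1_l, !Cpow_1_r in T1. fold q w in T1, T2, T4, T8.
  unfold tfun, ffun. rewrite T1, T2, T4, T8. split.
  (* The powers of [w] add up to [4 + 4*2 + 8*4 - 2*10 = 24], that is to one factor [q], and for
     [ffun] to [2*10 - 4 - 4*4 = 0]. The fifth occurrence of [q] is that factor in [hauptmodul]; the
     earlier ones are arguments of [E]. *)
  - unfold hauptmodul. rewrite Ew at 5. field. nz.
  - replace (theta q) with (E (q ^ 2) ^ 5 / (E q ^ 2 * E (q ^ 4) ^ 2))%C.
    + field. nz.
    + rewrite <- theta_eta by trivial. field. now split.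
Qed.

(* "In a neighbourhood of tau = i*infinity": for all tau with Im tau large
   enough, the series sum_n P_n t(tau)^n converges to f(tau). *)
Theorem theorem8 (P : nat -> R) (hP : is_CLF P) :
  exists Y : R, 0 < Y /\
    forall tau : C, Y < Im tau ->
      is_series (fun n : nat => Cmult (RtoC (P n)) (Cpow (tfun tau) n)) (ffun tau).
Proof.
  destruct (CLF_theta P hP) as [r [Hr H]]. exists (/ r). split; [apply Rinv_0_lt_compat; lra|].
  intros tau Htau. assert (Hq := Cmod_qnome_small tau r (proj1 Hr) Htau).
  destruct (eta_quotients tau) as [Et Ef]; [lra|].
  destruct (H (qnome tau)) as [A B]; [apply Cexp_neq_0 | trivial |].
  rewrite Et, Ef, <- B. apply cpower_correct; trivial. now apply CLF_geometric.
Qed.
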